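(* Let $\mathfrak g$ be a Lie algebra over a field $\mathbb K$ of characteristic zero and let $H$ be a $\mathfrak g$-module, regarded as an abelian Lie algebra $\mathfrak h:=H$. Let $(L,d,[\ ,\ ])$ be the differential graded Lie algebra $C_>(\mathfrak g\oplus\mathfrak h,\mathfrak h)$, and let $\alpha$ denote the module structure $\mathfrak g\times H\to H$, or more precisely its antisymmetrization, i.e. $\alpha(g_1+h_1,g_2+h_2)=g_1\cdot h_2-g_2\cdot h_1$. Then the Chevalley-Eilenberg complex $(C(\mathfrak g,H),\delta)$ is a sub differential graded Lie algebra of $L_\alpha$, the tangent complex of $L$ at $\alpha$.
   Context: **Chevalley-Eilenberg complex.** $C(\mathfrak g,H)$ is the graded space of antisymmetric multilinear maps from $\mathfrak g$ to $H$, $C^n(\mathfrak g,H)=\mathrm{Hom}(\wedge^n\mathfrak g,H)$, with differential $$\delta c(g_1,\dots,g_n)=\sum_{s}(-1)^{s}g_s\cdot c(g_1,\dots,\widehat{g_s},\dots,g_n)+\sum_{i<j}(-1)^{i+j+1}c([g_i,g_j],g_1,\dots,\widehat{g_i},\dots,\widehat{g_j},\dots,g_n),$$ where $\widehat{\ }$ indicates omission. An element of $C^n(\mathfrak g,H)$ is viewed as a multilinear map on $\mathfrak g\oplus H$ depending only on the $\mathfrak g$-components of its arguments, and is given degree $n-1$. **Nijenhuis-Richardson bracket.** For a Lie algebra $\mathfrak l$ with bracket $\rho_{\mathfrak l}$, let $C^n(\mathfrak l,\mathfrak l)=\mathrm{Hom}(\wedge^n\mathfrak l,\mathfrak l)$,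 where an element of $C^{p+1}(\mathfrak l,\mathfrak l)$ has degree $p$. For $P$ of degree $p$ and $Q$ of degree $q$, $[P,Q]:=i_PQ-(-1)^{pq}i_QP$, with $i_PQ(l_0,\dots,l_{p+q}):=\sum_\sigma \mathrm{sign}(\sigma)\,Q(P(l_{\sigma(0)},\dots,l_{\sigma(p)}),l_{\sigma(p+1)},\dots,l_{\sigma(p+q)})$, sum over permutations $\sigma$ with $\sigma(0)<\dots<\sigma(p)$ and $\sigma(p+1)<\dots<\sigma(p+q)$. With $d:=[\rho_{\mathfrak l},\ ]$ this is a differential graded Lie algebra (dgLa). **The dgLa $L$.** Take $\mathfrak l=\mathfrak g\oplus\mathfrak h$ (direct sum of Lie algebras), so $d=[\rho_{\mathfrak g}+\rho_{\mathfrak h},\ ]$ with $\rho_{\mathfrak g},\rho_{\mathfrak h}$ the brackets of $\mathfrak g,\mathfrak h$ (here $\rho_{\mathfrak h}=0$). Using $\wedge^\bullet(\mathfrak g\oplus\mathfrak h)\simeq\wedge^\bullet\mathfrak g\otimes\wedge^\bullet\mathfrak h$, let $C^{m,n}=\mathrm{Hom}(\wedge^m\mathfrak g\otimes\wedge^n\mathfrak h,\mathfrak h)$, viewed inside $C^{m+n}(\mathfrak g\oplus\mathfrak h,\mathfrak g\oplus\mathfrak h)$, in degree $m+n-1$. Then $L=C_>(\mathfrak g\oplus\mathfrak h,\mathfrak h)=\bigoplus_{m\ge1,n\ge0}C^{m,n}$ is a sub-dgLa. **Tangent complex.** For a dgLa $(V,[\ ,\ ],d)$ and a Maurer-Cartan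 element $\alpha$ (a degree one element with $d\alpha+\frac12[\alpha,\alpha]=0$), the tangent complex at $\alpha$ is the dgLa $(V,[\ ,\ ],d_\alpha)$ with the same bracket and $d_\alpha(u)=d(u)+[\alpha,u]$.
   Formalization: The Chevalley-Eilenberg complex is taken only in C^n(g,H) with n ≥ 1: the term C^0(g,H)=H would sit in degree −1, where L (built from C^{m,n} with m ≥ 1) is zero, so for nonzero H the claim fails with that term included. *)

(* Defs.v *)
From mathcomp Require Import all_boot all_order all_algebra all_fingroup.
From mathcomp Require Import boolp classical_sets functions.
Set Implicit Arguments.
Unset Strict Implicit.
Unset Printing Implicit Defensive.
Import GRing.Theory.
Local Open Scope classical_set_scope.
Local Open Scope ring_scope.

Definition is_submodule (K : fieldType) (V : lmodType K) (W : set V) : Prop :=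
  W 0 /\ (forall (a : K) (x y : V), W x -> W y -> W (a *: x + y)).

Definition linear_on (K : fieldType) (V V' : lmodType K) (W : set V)
    (f : V -> V') : Prop :=
  forall (a : K) (x y : V), W x -> W y -> f (a *: x + y) = a *: f x + f y.

(* Nonnegatively graded differential graded Lie algebras.  The component of   *)
(* degree k is the subset [dg_part V k] of an ambient module [dg_space V k];  *)
(* the operations are total on the ambient modules, and all the axioms are    *)
(* relative to the subsets.                                                   *)
Record dgLa_data (K : fieldType) := DgLaData {
  dg_space : nat -> lmodType K;
  dg_part : forall k, set (dg_space k);
  dg_br : forall i j, dg_space i -> dg_space j -> dg_space (i + j)%N;
  dg_diff : forall k, dg_space k -> dg_space k.+1 }.

Arguments dg_br {K} d [i j].
Arguments dg_diff {K} d [k].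

(* Identification of the components of provably equal degrees. *)
Definition dg_cast (K : fieldType) (V : dgLa_data K) (i j : nat) (e : i = j)
    (x : dg_space V i) : dg_space V j :=
  ecast k (dg_space V k) e x.

Record is_dgLa (K : fieldType) (V : dgLa_data K) : Prop := IsDgLa {
  dg_submodule : forall k, is_submodule (@dg_part K V k);
  dg_br_closed : forall i j (x : dg_space V i) (y : dg_space V j),
    dg_part x -> dg_part y -> dg_part (dg_br V x y);
  dg_br_linearl : forall i j (y : dg_space V j), dg_part y ->
    linear_on (@dg_part K V i) (fun x => dg_br V x y);
  dg_br_linearr : forall i j (x : dg_space V i), dg_part x ->
    linear_on (@dg_part K V j) (fun y => dg_br V x y);
  dg_br_antisym : forall i j (x : dg_space V i) (y : dg_space V j),
    dg_part x -> dg_part y ->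
    dg_br V x y = - ((-1) ^+ (i * j)%N *: dg_cast (addnC j i) (dg_br V y x));
  dg_br_jacobi : forall i j k
      (x : dg_space V i) (y : dg_space V j) (z : dg_space V k),
    dg_part x -> dg_part y -> dg_part z ->
    dg_br V x (dg_br V y z) =
      dg_cast (esym (addnA i j k)) (dg_br V (dg_br V x y) z)
      + (-1) ^+ (i * j)%N
        *: dg_cast (esym (addnCA i j k)) (dg_br V y (dg_br V x z));
  dg_diff_closed : forall k (x : dg_space V k),
    dg_part x -> dg_part (dg_diff V x);
  dg_diff_linear : forall k, linear_on (@dg_part K V k) (dg_diff V (k := k));
  dg_diff_diff : forall k (x : dg_space V k),
    dg_part x -> dg_diff V (dg_diff V x) = 0;
  dg_diff_leibniz : forall i j (x : dg_space V i) (y : dg_space V j),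
    dg_part x -> dg_part y ->
    dg_diff V (dg_br V x y) =
      dg_br V (dg_diff V x) y
      + (-1) ^+ i *: dg_cast (addnS i j) (dg_br V x (dg_diff V y)) }.

Definition is_maurer_cartan (K : fieldType) (V : dgLa_data K)
    (a : dg_space V 1) : Prop :=
  dg_part a /\ dg_diff V a + 2%:R^-1 *: dg_br V a a = 0.

Definition tangent_complex (K : fieldType) (V : dgLa_data K)
    (a : dg_space V 1) : dgLa_data K :=
  @DgLaData K (dg_space V) (@dg_part K V) (@dg_br K V)
    (fun k u => dg_diff V u + dg_br V a u).

Record complex_data (K : fieldType) := ComplexData {
  cx_space : nat -> lmodType K;
  cx_part : forall k, set (cx_space k);
  cx_diff : forall k, cx_space k -> cx_space k.+1 }.

Arguments cx_diff {K} c [k].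

(* The complex [C] is a sub-dgLa of [V], by means of the inclusion [f]; its   *)
(* bracket is the one induced by [V].                                         *)
Record is_sub_dgLa (K : fieldType) (C : complex_data K) (V : dgLa_data K)
    (f : forall k, cx_space C k -> dg_space V k) : Prop := IsSubDgLa {
  sub_dgLa : is_dgLa V;
  sub_submodule : forall k, is_submodule (@cx_part K C k);
  sub_diff_closed : forall k (c : cx_space C k),
    cx_part c -> cx_part (cx_diff C c);
  sub_linear : forall k, linear_on (@cx_part K C k) (f k);
  sub_inj : forall k (c c' : cx_space C k),
    cx_part c -> cx_part c' -> f k c = f k c' -> c = c';
  sub_into : forall k (c : cx_space C k), cx_part c -> dg_part (f k c);
  sub_br_closed : forall i j (c : cx_space C i) (c' : cx_space C j),
    cx_part c -> cx_part c' ->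
    (f (i + j)%N @` cx_part (k := (i + j)%N)) (dg_br V (f i c) (f j c'));
  sub_diff : forall k (c : cx_space C k),
    cx_part c -> f k.+1 (cx_diff C c) = dg_diff V (f k c) }.

Record is_lie_bracket (K : fieldType) (g : lmodType K) (br : g -> g -> g) :
    Prop := IsLieBracket {
  lie_linearl : forall y, linear (fun x => br x y);
  lie_linearr : forall x, linear (br x);
  lie_alt : forall x, br x x = 0;
  lie_jacobi : forall x y z,
    br x (br y z) + br y (br z x) + br z (br x y) = 0 }.

Record is_lie_action (K : fieldType) (g H : lmodType K) (br : g -> g -> g)
    (act : g -> H -> H) : Prop := IsLieAction {
  act_linearl : forall h, linear (fun x => act x h);
  act_linearr : forall x, linear (act x);
  act_br : forall x y h,
    act (br x y) h = act x (act y h) - act y (act x h) }.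

Definition abelian_br (K : fieldType) (H : lmodType K) : H -> H -> H :=
  fun _ _ => 0.

Definition sum_br (K : fieldType) (g h : lmodType K) (brg : g -> g -> g)
    (brh : h -> h -> h) (x y : g * h) : g * h :=
  (brg x.1 y.1, brh x.2 y.2).

(* All maps V^n -> W, with their pointwise module structure. *)
Definition nmap (K : fieldType) (n : nat) (V W : lmodType K) : lmodType K :=
  (('I_n -> V) -> W : lmodType K).

Definition upd (V : Type) (n : nat) (l : 'I_n -> V) (i : 'I_n) (x : V) :
    'I_n -> V :=
  fun j => if j == i then x else l j.

(* Hom(/\^n V, W), in characteristic zero. *)
Definition cochain (K : fieldType) (n : nat) (V W : lmodType K) :
    set (nmap n V W) :=
  [set c | (forall (l : 'I_n -> V) (i : 'I_n),
              linear (fun x : V => c (upd l i x)))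
         /\ (forall (l : 'I_n -> V) (s : 'S_n),
              c (fun i => l (s i)) = (-1) ^+ s *: c l)].

Definition shuffle (a b : nat) (s : 'S_(a + b)) : bool :=
  [forall i : 'I_a, forall j : 'I_a, (i < j)%N ==>
     (s (lshift b i) < s (lshift b j))%N]
  && [forall i : 'I_b, forall j : 'I_b, (i < j)%N ==>
     (s (rshift a i) < s (rshift a j))%N].

(* i_P Q, for P of arity a and Q of arity b + 1. *)
Definition insertion (K : fieldType) (V : lmodType K) (a b : nat)
    (P : nmap a V V) (Q : nmap b.+1 V V) : nmap (a + b) V V :=
  fun l => \sum_(s : 'S_(a + b) | shuffle s)
    (-1) ^+ s *: Q (fun t : 'I_b.+1 =>
      if unlift ord0 t is Some u then l (s (rshift a u))
      else P (fun i => l (s (lshift b i)))).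

(* P and Q have degrees p and q, hence arities p + 1 and q + 1. *)
Definition nr_br (K : fieldType) (V : lmodType K) (p q : nat)
    (P : nmap p.+1 V V) (Q : nmap q.+1 V V) : nmap (p + q).+1 V V :=
  fun l => insertion P Q l
    - (-1) ^+ (p * q)%N
      *: insertion Q P (fun i => l (cast_ord (congr1 succn (addnC q p)) i)).

(* A Lie bracket as a cochain of degree 1. *)
Definition br_cochain (K : fieldType) (V : lmodType K) (br : V -> V -> V) :
    nmap 2 V V :=
  fun l => br (l ord0) (l ord_max).

(* C^{m,n} for m <= N and n = N - m, inside C^N(g + h, g + h): the h-valued   *)
(* cochains that vanish whenever each argument lies in g or in h, unless      *)
(* exactly m of them (those with index in S) are taken in g.                  *)
Definition bicochain (K : fieldType) (g h : lmodType K) (N m : nat) :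
    set (nmap N (g * h)%type (g * h)%type) :=
  [set c | [/\ @cochain K N (g * h)%type (g * h)%type c,
      (forall l, (c l).1 = 0)
    & (forall (S : {set 'I_N}) (l : 'I_N -> g * h),
        (forall i, if i \in S then (l i).2 = 0 else (l i).1 = 0) ->
        #|S| <> m -> c l = 0)]].

(* Degree k of C_>(g + h, h): the sum of the C^{m, k + 1 - m} for m >= 1.     *)
Definition Cgt_part (K : fieldType) (g h : lmodType K) (k : nat) :
    set (nmap k.+1 (g * h)%type (g * h)%type) :=
  [set P | exists c : nat -> nmap k.+1 (g * h)%type (g * h)%type,
      (forall m, (1 <= m < k.+2)%N -> bicochain m (c m))
      /\ P = \sum_(1 <= m < k.+2) c m].

(* Only nonnegative degrees occur, as m >= 1 in every C^{m,n}. *)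
Definition Cgt (K : fieldType) (g h : lmodType K) (brg : g -> g -> g)
    (brh : h -> h -> h) : dgLa_data K :=
  @DgLaData K (fun k => nmap k.+1 (g * h)%type (g * h)%type)
    (@Cgt_part K g h)
    (fun p q P Q => nr_br P Q)
    (fun k P => nr_br (p := 1) (br_cochain (sum_br brg brh)) P).

Definition action_cochain (K : fieldType) (g H : lmodType K)
    (act : g -> H -> H) : nmap 2 (g * H)%type (g * H)%type :=
  fun l => (0, act (l ord0).1 (l ord_max).2 - act (l ord_max).1 (l ord0).2).

(* With indices starting at 0, the signs (-1)^s and (-1)^(i+j+1) for indices  *)
(* starting at 1 become (-1)^(s+1) and (-1)^(i+j+1).  The second sum ranges   *)
(* over i < j, and bump j (bump i u) is the u-th index other than i and j.    *)
Definition ce_diff (K : fieldType) (g H : lmodType K) (br : g -> g -> g)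
    (act : g -> H -> H) (n : nat) (c : nmap n g H) : nmap n.+1 g H :=
  fun x =>
    \sum_(s < n.+1) (-1) ^+ s.+1 *: act (x s) (c (fun t => x (lift s t)))
    + \sum_(i < n.+1) \sum_(j < n.+1 | (i < j)%N)
        (-1) ^+ (i + j).+1 *: c (fun t : 'I_n =>
          if t == 0%N :> nat then br (x i) (x j)
          else x (inord (bump j (bump i t.-1)))).

(* C^{k+1}(g, H) is in degree k.  C^0(g, H) = H, in degree -1, is left out:   *)
(* it is not contained in C_>(g + h, h).                                      *)
Definition chevalley_eilenberg (K : fieldType) (g H : lmodType K)
    (br : g -> g -> g) (act : g -> H -> H) : complex_data K :=
  @ComplexData K (fun k => nmap k.+1 g H) (fun k => @cochain K k.+1 g H)
    (fun k c => ce_diff br act c).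

(* A cochain on g as a map on g + H depending only on the g-components. *)
Definition ce_incl (K : fieldType) (g H : lmodType K) (k : nat)
    (c : nmap k.+1 g H) : nmap k.+1 (g * H)%type (g * H)%type :=
  fun l => (0, c (fun i => (l i).1)).

(* Main.v *)
(* Cochains are read as functions of lists, so that arities and casts vanish.  *)
(* The signed sum over unshuffles of a list is a coassociative and graded      *)
(* cocommutative coproduct (induction on the list), and insertion is expressed *)
(* by it; hence insertion is a graded left pre-Lie product and its graded      *)
(* commutator, the Nijenhuis-Richardson bracket, satisfies the Jacobi          *)
(* identity.  Adding alpha to rho_g turns it into the bracket mu of the        *)
(* semidirect product of g and H, and d_alpha = [mu, ]; that mu is a Lie       *)
(* bracket says [mu, mu] = 0, which gives d_alpha^2 = 0 and the Maurer-Cartan  *)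
(* equation.  On cochains of g with values in H, [mu, ] is the                 *)
(* Chevalley-Eilenberg differential and the bracket vanishes.                  *)

Require Import Defs.
From mathcomp Require Import all_boot all_order all_algebra all_fingroup.
From mathcomp Require Import boolp classical_sets functions.
From mathcomp Require Import ring zify.
Set Implicit Arguments.
Unset Strict Implicit.
Unset Printing Implicit Defensive.
Import GRing.Theory.
Local Open Scope ring_scope.

(** * Signed sums over unshuffles *)

(** The core is the graded Jacobi identity for the Nijenhuis-Richardson bracket. Read through [ev]
    as functions of lists, cochains are inserted into each other by [ins], built on the unshuffle
    coproduct [shsum]. Coassociativity ([shsumA]) splits [ins f (ins g h)] into [ins (ins f g) h]
    and the part where f and g fill different slots of h ([ins_insE]); cocommutativity ([shsumC])
    makes that part graded symmetric in f and g ([ins2C]). This is the left pre-Lie identity, whence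
    [gbr_jacobi], and [shsum_shuffles] carries it back to sums over permutations.

    By [nr_dgLa], a degree-one cochain mu with [mu, mu] = 0 turns every graded subspace stable under
    the bracket and under [mu, ] into a dgLa. This is applied twice to C_>, in its intrinsic form
    [vertical] ([Cgt_partP]): the bracket rho of the direct sum gives L, the bracket rho + alpha of
    the semidirect product gives L_alpha. Expanding [rho + alpha, rho + alpha] = 0 gives the
    Maurer-Cartan equation. On a cochain c of g, inserting mu into c produces the terms with
    [g_i, g_j], inserting c into mu those with the action ([ce_incl_diff]). *)

Section ShuffleSum.
Variables (K : fieldType) (V W : lmodType K).
Implicit Types (s A B C D : seq V) (F G : seq V -> seq V -> W) (f : seq V -> W).

(** The sum of F over all splittings of s into complementary subsequences A and B, with the sign of
    the unshuffle: a letter sent to B has to pass all of A. *)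
Fixpoint shsum s F : W :=
  if s is x :: s' then
    shsum s' (fun A B => F (x :: A) B)
    + shsum s' (fun A B => (-1) ^+ size A *: F A (x :: B))
  else F [::] [::].

Lemma eq_shsum s F G :
  (forall A B, perm_eq (A ++ B) s -> F A B = G A B) -> shsum s F = shsum s G.
Proof.
elim: s F G => [|x s IH] F G eqFG /=; first exact: eqFG.
congr (_ + _); apply: IH => A B pAB; first by apply: eqFG; rewrite /= perm_cons.
by congr (_ *: _); apply: eqFG; rewrite -cat1s perm_catCA /= perm_cons.
Qed.

Lemma eq_shsum_size s F G :
    (forall A B, (size A + size B)%N = size s -> F A B = G A B) ->
  shsum s F = shsum s G.
Proof.
by move=> eqFG; apply: eq_shsum => A B /perm_size; rewrite size_cat => /eqFG.
Qed.

Lemma eq_shsum_fun s F G : (forall A B, F A B = G A B) -> shsum s F = shsum s G.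
Proof. by move=> eqFG; apply: eq_shsum. Qed.

Lemma shsumD s F G :
  shsum s (fun A B => F A B + G A B) = shsum s F + shsum s G.
Proof.
elim: s F G => [|x s IH] F G //=; rewrite IH addrACA; congr (_ + _).
by rewrite -IH; apply: eq_shsum_fun => A B; rewrite scalerDr.
Qed.

Lemma shsumZ s a F : shsum s (fun A B => a *: F A B) = a *: shsum s F.
Proof.
elim: s F => [|x s IH] F //=; rewrite IH scalerDr; congr (_ + _).
by rewrite -IH; apply: eq_shsum_fun => A B; rewrite !scalerA mulrC.
Qed.

Lemma shsum0 s : shsum s (fun _ _ => 0) = 0.
Proof.
rewrite -[RHS](scale0r (shsum s (fun _ _ => 0))) -shsumZ.
by apply: eq_shsum_fun => A B; rewrite scaler0.
Qed.

Lemma shsum_eq0 s F :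
  (forall A B, perm_eq (A ++ B) s -> F A B = 0) -> shsum s F = 0.
Proof. by move=> F0; rewrite -(shsum0 s); apply: eq_shsum. Qed.

Lemma shsumC s F :
  shsum s F = shsum s (fun A B => (-1) ^+ (size A * size B) *: F B A).
Proof.
elim: s F => [|x s IH] F /=; first by rewrite scale1r.
rewrite addrC [X in X + _]IH [X in _ + X]IH.
congr (_ + _); apply: eq_shsum_fun => A B /=.
  by rewrite scalerA -exprD mulSn addnC.
by rewrite scalerA mulnS exprD mulrA -expr2 sqrr_sign mul1r.
Qed.

End ShuffleSum.

(** Coassociativity: both sides run over the splittings of s into three blocks. In the induction the
    head of s goes to C, D or B, with signs 1, (-1)^|C| and (-1)^(|C|+|D|) on either side. *)
Lemma shsumA (K : fieldType) (V W : lmodType K) (s : seq V)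
    (F : seq V -> seq V -> seq V -> W) :
  shsum s (fun A B => shsum A (fun C D => F C D B))
  = shsum s (fun C E => shsum E (fun D B => F C D B)).
Proof.
elim: s F => [|x s IH] F //=; rewrite shsumD IH -addrA; congr (_ + _).
under [in RHS]eq_shsum_fun => C E do rewrite scalerDr.
rewrite shsumD; congr (_ + _).
  rewrite IH; apply: eq_shsum_fun => C E; exact: shsumZ.
under eq_shsum_fun => A B do rewrite -shsumZ.
transitivity (shsum s (fun A B => shsum A (fun C D =>
  (-1) ^+ (size C + size D) *: F C D (x :: B)))).
  apply: eq_shsum_fun => A B; apply: eq_shsum_size => C D <- //.
rewrite IH; apply: eq_shsum_fun => C E; rewrite -shsumZ.
by apply: eq_shsum_fun => D B; rewrite scalerA exprD.
Qed.

(** * Skew-symmetric multilinear functions of lists *)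

Section Skew.
Variables (K : fieldType) (V W : lmodType K).
Implicit Types (s A B C D : seq V) (F G : seq V -> seq V -> W) (f : seq V -> W).

(* Skew-symmetric multilinear functions of finitely many arguments, given as  *)
(* functions of the list of the arguments.                                    *)
Definition skewml f :=
  (forall s1 s2 (a : K) x y,
     f (s1 ++ (a *: x + y) :: s2) = a *: f (s1 ++ x :: s2) + f (s1 ++ y :: s2))
  /\ (forall s1 s2 x y, f (s1 ++ x :: y :: s2) = - f (s1 ++ y :: x :: s2)).

Lemma skew_cons f (x : V) :
  skewml f -> skewml (fun s => f (x :: s)).
Proof.
by case=> lf sf; split=> s1 *; [exact: (lf (x :: s1)) | exact: (sf (x :: s1))].
Qed.

Lemma skew_lin f s : skewml f -> linear (fun x => f (x :: s)).
Proof. by case=> lf _ a x y; exact: (lf [::]). Qed.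

Lemma skewZ f a : skewml f -> skewml (fun s => a *: f s).
Proof.
case=> lf sf; split=> s1 s2 *; last by rewrite sf scalerN.
by rewrite lf scalerDr !scalerA mulrC.
Qed.

Lemma skewD f1 f2 : skewml f1 -> skewml f2 -> skewml (fun s => f1 s + f2 s).
Proof.
case=> lf sf [lg sg]; split=> s1 s2 *; last by rewrite sf sg opprD.
by rewrite lf lg scalerDr addrACA.
Qed.

Lemma skew_sign f : skewml f -> skewml (fun s => (-1) ^+ size s *: f s).
Proof.
case=> lf sf; split=> s1 s2 *; last by rewrite sf scalerN !size_cat.
by rewrite lf scalerDr !size_cat /= !scalerA mulrC.
Qed.

Lemma skew_move f s1 x s2 :
  skewml f -> f (s1 ++ x :: s2) = (-1) ^+ size s1 *: f (x :: s1 ++ s2).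
Proof.
move=> sf; elim/last_ind: s1 s2 => [|s1 y IH] s2; first by rewrite scale1r.
rewrite cat_rcons (proj2 sf) IH size_rcons exprS -scalerA scaleN1r.
by rewrite cat_rcons.
Qed.

Lemma skew_swap f x y s : skewml f -> f (x :: y :: s) = - f (y :: x :: s).
Proof. by case=> _ sf; exact: (sf [::]). Qed.

(** For neighbours x and y, the terms with both in one block change sign by skewness of F there. The
    terms with x and y in different blocks trade places with opposite signs, since the two letters
    cross in exactly one of them. *)
Lemma skew_shsum F :
    (forall B, skewml (F ^~ B)) -> (forall A, skewml (F A)) ->
  skewml (fun s => shsum s F).
Proof.
move=> sF1 sF2; split.
  move=> s1; elim: s1 F sF1 sF2 => [|z s1 IH] F sF1 sF2 s2 a x y /=.
    rewrite scalerDr addrACA; congr (_ + _);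
      rewrite -shsumZ -shsumD; apply: eq_shsum_fun => A B.
      exact: (skew_lin A (sF1 B)).
    by rewrite (skew_lin B (sF2 A)) scalerDr !scalerA mulrC.
  rewrite scalerDr addrACA; congr (_ + _).
    by apply: IH => [B|A]; [exact: skew_cons (sF1 B) | exact: sF2].
  apply: IH => [B|A]; first exact: skew_sign.
  by apply: skewZ; apply: (skew_cons z (sF2 A)).
move=> s1; elim: s1 F sF1 sF2 => [|z s1 IH] F sF1 sF2 s2 x y /=.
  rewrite -!shsumD -scaleN1r -shsumZ.
  apply: eq_shsum_fun => A B; rewrite scaleN1r (skew_swap x y _ (sF1 B)).
  rewrite (skew_swap x y _ (sF2 A)) /= exprS mulN1r !scaleNr !scalerN !opprD.
  by rewrite !opprK -!addrA; congr (_ + _); rewrite [LHS]addrCA.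
rewrite opprD; congr (_ + _).
  by apply: IH => [B|A]; [exact: skew_cons (sF1 B) | exact: sF2].
apply: IH => [B|A]; first exact: skew_sign.
by apply: skewZ; apply: (skew_cons z (sF2 A)).
Qed.

End Skew.

(** * The insertion product *)

Lemma linear_fun0 (K : fieldType) (V W : lmodType K) (f : V -> W) :
  linear f -> f 0 = 0.
Proof. by move=> lf; have := lf (-1) 0 0; rewrite scaler0 addr0 scaleN1r addNr. Qed.

Lemma linear_funN (K : fieldType) (V W : lmodType K) (f : V -> W) x :
  linear f -> f (- x) = - f x.
Proof.
by move=> lf; have := lf (-1) x 0; rewrite (linear_fun0 lf) !addr0 !scaleN1r.
Qed.

Lemma linear_shsum (K : fieldType) (U V W : lmodType K) (f : V -> W)
    (s : seq U) F :
  linear f -> f (shsum s F) = shsum s (fun A B => f (F A B)).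
Proof.
move=> lf; elim: s F => [|x s IH] F //=.
have fD y z : f (y + z) = f y + f z by have := lf 1 y z; rewrite !scale1r.
rewrite fD !IH; congr (_ + _).
apply: eq_shsum_fun => A B; have := lf ((-1) ^+ size A) (F A (x :: B)) 0.
by rewrite (linear_fun0 lf) !addr0.
Qed.

(** Bookkeeping for [gbr_jacobi]: a, b, c are the signs of the pairs (f, g), (f, h), (g, h), the xi
    are the six nested insertions [ins (ins _ _) _], and T1, T2, T3 the two-slot terms with outer
    map h, g, f. *)
Lemma jacobi_signs (K : fieldType) (V : lmodType K) (a b c : K)
    (x1 x2 x3 x4 x5 x6 T1 T2 T3 : V) :
  a ^+ 2 = 1 -> c ^+ 2 = 1 ->
  (x1 + a *: T1) - c *: (x3 + b *: T2) - (a * b) *: (x5 - c *: x6) =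
  (x1 - a *: x2) - (b * c) *: ((x4 + T2) - a *: (x6 + c *: T3))
  + a *: (((x2 + T1) - b *: (x5 + T3)) - (a * c) *: (x3 - b *: x4)).
Proof.
move=> a2 c2.
rewrite !(scalerDr, scalerN, scalerA, opprD, opprK, addrA).
have -> : b * c * a * c = a * b by rewrite -[RHS]mulr1 -c2; ring.
have -> : a * (a * c) = c by rewrite -[RHS]mul1r -a2; ring.
rewrite [RHS](ACl ((1*8*11*4*9*5)*(2*7)*(3*12)*(6*10))%AC) /=.
rewrite !addNr subrr !addr0 (mulrC c b) addNr addr0.
by congr (_ + _ *: _); ring.
Qed.

Section Insertion.
Variables (K : fieldType) (V : lmodType K).
Implicit Types (s A B C D : seq V) (f g h : seq V -> V).

Definition homog n f := forall s, size s <> n -> f s = 0.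

Definition ins f g s := shsum s (fun A B => g (f A :: B)).

(* The part of [ins f (ins g h)] where f and g fill two distinct slots of h.  *)
Definition ins2 f g h s :=
  shsum s (fun A B => shsum B (fun C D =>
    (-1) ^+ size C *: h (g C :: f A :: D))).

Lemma skew_ins f g : skewml f -> skewml g -> skewml (ins f g).
Proof.
move=> [lf sf] sg; apply: skew_shsum => [B|A]; last exact: skew_cons.
split=> [s1 s2 a x y|s1 s2 x y]; first by rewrite lf (skew_lin B sg).
by rewrite sf (linear_funN _ (skew_lin B sg)).
Qed.

Lemma homog_ins p q f g :
  skewml g -> homog p f -> homog q.+1 g -> homog (p + q) (ins f g).
Proof.
move=> sg hf hg s sz; rewrite -(shsum0 V s); apply: eq_shsum_size => A B szAB.
have [szA|/eqP szA] := eqVneq (size A) p; last first.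
  by rewrite hf // (linear_fun0 (skew_lin B sg)).
by apply: hg => /= -[szB]; apply: sz; rewrite -szAB szA szB.
Qed.

(** The argument [f A] of [ins g h] is either fed to g, which coassociativity regroups as [ins f g]
    inserted into h, or stays in h next to the value of g. *)
Lemma ins_insE f g h s : skewml g -> skewml h ->
  ins f (ins g h) s = ins (ins f g) h s + ins2 f g h s.
Proof.
move=> sg sh; rewrite /ins /= shsumD; congr (_ + _).
rewrite -(shsumA s (fun C D B => h (g (f C :: D) :: B))).
apply: eq_shsum_fun => A B.
by rewrite (linear_shsum _ _ (skew_lin B sh)).
Qed.

(** Cocommutativity exchanges the blocks of f and g, skewness of h exchanges their values; the signs
    for arities p + 1 and q + 1 combine into the one for degrees p and q. *)
Lemma ins2C p q f g h s : skewml h -> homog p.+1 f -> homog q.+1 g ->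
  ins2 f g h s = (-1) ^+ (p * q) *: ins2 g f h s.
Proof.
move=> sh hf hg; rewrite /ins2 -!shsumA -shsumZ; apply: eq_shsum_fun => A B.
rewrite shsumC -shsumZ; apply: eq_shsum_fun => C D; rewrite !scalerA.
(* Blocks of the wrong size contribute 0 on both sides, so the exponents of the signs may be taken
   constant. *)
have [szC|/eqP szC] := eqVneq (size C) q.+1; last first.
  rewrite (hg C) // (linear_fun0 (skew_lin _ sh)).
  by rewrite (linear_fun0 (skew_lin B (skew_cons _ sh))) !scaler0.
have [szD|/eqP szD] := eqVneq (size D) p.+1; last first.
  rewrite (hf D) // (linear_fun0 (skew_lin _ sh)).
  by rewrite (linear_fun0 (skew_lin B (skew_cons _ sh))) !scaler0.
rewrite (skew_swap _ _ _ sh) szC szD scalerN -scaleNr; congr (_ *: _).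
rewrite -mulN1r -!exprD -exprS -signr_odd -[RHS]signr_odd; congr (_ ^+ _).
by rewrite !(oddD, oddM, oddS) /=; case: (odd p); case: (odd q).
Qed.

(** A function of lists does not carry its arity, so the degrees p and q are separate arguments. *)
Definition gbr p q f g s := ins f g s - (-1) ^+ (p * q) *: ins g f s.

Lemma skew_gbr p q f g : skewml f -> skewml g -> skewml (gbr p q f g).
Proof.
move=> sf sg; apply: skewD; first exact: skew_ins.
rewrite (_ : (fun s => _) = (fun s => - (-1) ^+ (p * q) *: ins g f s)).
  by apply: skewZ; apply: skew_ins.
by apply: funext => s; rewrite scaleNr.
Qed.

Lemma ins_linearr f g g1 g2 a s : (forall t, g t = a *: g1 t + g2 t) ->
  ins f g s = a *: ins f g1 s + ins f g2 s.
Proof.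
by move=> gE; rewrite /ins -shsumZ -shsumD; apply: eq_shsum_fun => A B.
Qed.

Lemma ins_linearl f f1 f2 g a s : skewml g ->
  (forall t, f t = a *: f1 t + f2 t) ->
  ins f g s = a *: ins f1 g s + ins f2 g s.
Proof.
move=> sg fE; rewrite /ins -shsumZ -shsumD; apply: eq_shsum_fun => A B.
by rewrite fE (skew_lin B sg).
Qed.

Lemma gbrE p q f g s : gbr p q f g s = - (-1) ^+ (p * q) *: ins g f s + ins f g s.
Proof. by rewrite /gbr addrC scaleNr. Qed.

Lemma gbr_linearr p q f g g1 g2 a s : skewml f ->
  (forall t, g t = a *: g1 t + g2 t) ->
  gbr p q f g s = a *: gbr p q f g1 s + gbr p q f g2 s.
Proof.
move=> sf gE; rewrite !gbrE (ins_linearr f s gE) (ins_linearl s sf gE).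
by rewrite !scalerDr !scalerA mulrC addrACA.
Qed.

Lemma gbr_linearl p q f f1 f2 g a s : skewml g ->
  (forall t, f t = a *: f1 t + f2 t) ->
  gbr p q f g s = a *: gbr p q f1 g s + gbr p q f2 g s.
Proof.
move=> sg fE; rewrite !gbrE (ins_linearr g s fE) (ins_linearl s sg fE).
by rewrite !scalerDr !scalerA mulrC addrACA.
Qed.

Lemma ins_gbr p q f g h s :
  ins f (gbr p q g h) s =
  ins f (ins g h) s - (-1) ^+ (p * q) *: ins f (ins h g) s.
Proof.
by rewrite (ins_linearr f s (gbrE p q g h)) addrC scaleNr.
Qed.

Lemma gbr_ins p q f g h s : skewml h ->
  ins (gbr p q f g) h s =
  ins (ins f g) h s - (-1) ^+ (p * q) *: ins (ins g f) h s.
Proof.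
by move=> sh; rewrite (ins_linearl s sh (gbrE p q f g)) addrC scaleNr.
Qed.

Lemma gbrC p q f g s :
  gbr p q f g s = - ((-1) ^+ (p * q) *: gbr q p g f s).
Proof.
rewrite /gbr scalerDr scalerN scalerA (mulnC q) -expr2 sqrr_sign scale1r.
by rewrite opprB addrC.
Qed.

Lemma gbr_jacobi p q r f g h s :
    skewml f -> skewml g -> skewml h ->
    homog p.+1 f -> homog q.+1 g -> homog r.+1 h ->
  gbr p (q + r) f (gbr q r g h) s =
  gbr (p + q) r (gbr p q f g) h s
  + (-1) ^+ (p * q) *: gbr q (p + r) g (gbr p r f h) s.
Proof.
move=> sf sg sh hf hg hh; rewrite /gbr !ins_gbr !gbr_ins //.
rewrite !ins_insE // (ins2C s sh hf hg) (ins2C s sf hh hg) (ins2C s sg hf hh).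
rewrite mulnDr mulnDl !mulnDr !exprD (mulnC r q) (mulnC q p).
by apply: jacobi_signs; rewrite sqrr_sign.
Qed.

End Insertion.

(** * Shuffles as permutations *)

(* Unlike [shuffle], indexed by the total size n, which allows induction on n. *)
Definition shuffle_at a n (s : 'S_n) : bool :=
  [forall i : 'I_n, forall j : 'I_n,
     (i < j)%N && ((j < a) || (a <= i))%N ==> (s i < s j)%N].

Lemma shuffle_atP a n (s : 'S_n) :
  reflect (forall i j : 'I_n,
             (i < j)%N -> (j < a)%N || (a <= i)%N -> (s i < s j)%N)
          (shuffle_at a s).
Proof.
apply: (iffP 'forall_forallP) => [sh i j ij ja | sh i j].
  by apply: (implyP (sh i j)); rewrite ij ja.
by apply/implyP => /andP[]; apply: sh.
Qed.

Lemma shuffle_atE a b (s : 'S_(a + b)) : shuffle s = shuffle_at a s.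
Proof.
apply/andP/shuffle_atP => [[/'forall_forallP sh1 /'forall_forallP sh2] i j | sh].
  case: (split_ordP i) => i' ->; case: (split_ordP j) => j' -> /= ij.
  - by move=> _; apply: (implyP (sh1 _ _)).
  - by have := ltn_ord i'; lia.
  - by have := ltn_ord j'; lia.
  - by move=> _; apply: (implyP (sh2 _ _)); lia.
split; apply/'forall_forallP => i j; apply/implyP => ij; apply: sh => //=.
- by rewrite ltn_ord.
- by rewrite ltn_add2l.
- by rewrite leq_addr orbT.
Qed.

Lemma map_enum_lift (T : Type) n (f : 'I_n.+1 -> T) (f' : 'I_n -> T)
    (k : 'I_n.+1) :
  (forall i, f (lift k i) = f' i) ->
  [seq f i | i <- enum 'I_n.+1] =
  take k [seq f' i | i <- enum 'I_n]
  ++ f k :: drop k [seq f' i | i <- enum 'I_n].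
Proof.
move=> f'E; have szT : size (take k [seq f' i | i <- enum 'I_n]) = k.
  by rewrite size_takel // size_map size_enum_ord -ltnS.
apply: (@eq_from_nth _ (f k)).
  rewrite size_cat szT size_map size_enum_ord /= size_drop size_map size_enum_ord.
  by have := ltn_ord k; lia.
move=> i; rewrite size_map size_enum_ord => ltin.
rewrite (nth_map k) ?size_enum_ord // nth_cat szT.
have -> : nth k (enum 'I_n.+1) i = Ordinal ltin.
  by apply: val_inj; rewrite /= nth_enum_ord.
have [ltik|leki] := ltnP i k.
  have ltin' : (i < n)%N by have := ltn_ord k; lia.
  rewrite nth_take // (nth_map (Ordinal ltin')) ?size_enum_ord // -f'E; congr f.
  by apply: val_inj; rewrite /= nth_enum_ord // /bump leqNgt ltik.
case: (i - k)%N (subnK leki) => [|j] /= def_i.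
  by congr f; apply: val_inj.
rewrite nth_drop; have ltjn : (k + j < n)%N by lia.
rewrite (nth_map (Ordinal ltjn)) ?size_enum_ord // -f'E; congr f.
by apply: val_inj; rewrite /= nth_enum_ord // /bump leq_addr; lia.
Qed.

Lemma lift_perm0_bij n :
  bijective (fun p : 'I_n.+1 * 'S_n => lift_perm p.1 ord0 p.2).
Proof.
apply: inj_card_bij; last first.
  by rewrite card_prod card_ord !card_Sn.
move=> [k u] [k' u'] /= eq_su.
have eq_k : k = k'.
  by apply: (@perm_inj _ (lift_perm k ord0 u)); rewrite {2}eq_su !lift_perm_id.
rewrite -{}eq_k in eq_su *; congr pair; apply/permP=> i.
by apply: (@lift_inj _ ord0); rewrite -!(lift_perm_lift k) eq_su.
Qed.

Lemma shuffle_at_lift0 a n (u : 'S_n) :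
  shuffle_at a.+1 (lift_perm ord0 ord0 u) = shuffle_at a u.
Proof.
apply/shuffle_atP/shuffle_atP => sh i j.
  move=> ij ja; have := sh (lift ord0 i) (lift ord0 j).
  by rewrite !lift_perm_lift /= /bump !leq0n !add1n !ltnS; apply.
case: (unliftP ord0 j) => [j'|] -> //.
case: (unliftP ord0 i) => [i'|] ->; rewrite ?lift_perm_id !lift_perm_lift //=.
by rewrite /bump !leq0n !add1n !ltnS; apply: sh.
Qed.

Lemma shuffle_at_lift a n (u : 'S_n) (k : 'I_n.+1) : k = a :> nat ->
  shuffle_at a (lift_perm k ord0 u) = shuffle_at a u.
Proof.
move=> ka; apply/shuffle_atP/shuffle_atP => sh i j.
  move=> ij ja; have := sh (lift k i) (lift k j).
  rewrite !lift_perm_lift /= /bump !leq0n !add1n !ltnS ka; apply; lia.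
case: (unliftP k j) => [j'|] ->; case: (unliftP k i) => [i'|] ->;
  rewrite ?lift_perm_id ?lift_perm_lift /= /bump ?leq0n ?add1n ?ltnS //; try lia.
by rewrite ka => ij ja; apply: sh; lia.
Qed.

(** Positions k - 1 and k lie in the same block, and a shuffle cannot decrease from one to the next
    to reach the value 0. *)
Lemma shuffle_at_lift_neq a n (u : 'S_n) (k : 'I_n.+1) :
  k != ord0 -> k <> a :> nat -> shuffle_at a (lift_perm k ord0 u) = false.
Proof.
move=> k0 ka; apply/negP => /shuffle_atP sh.
have ltkn : (k.-1 < n.+1)%N by have := ltn_ord k; lia.
have k_gt0 : (0 < k)%N by rewrite lt0n.
have := sh (Ordinal ltkn) k; rewrite lift_perm_id ltn0 => /(_ _ _)/implyP.
rewrite /=; lia.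
Qed.

(* A permutation s is determined by the position k of its value 0 and by what *)
(* remains when both are deleted; a shuffle has k = 0 or k = a, which is the  *)
(* recursion defining [shsum]. *)
Lemma shsum_shuffles (K : fieldType) (V W : lmodType K) n a (x0 : V) (s : seq V)
    (F : seq V -> seq V -> W) :
    size s = n -> (forall A B, size A <> a -> F A B = 0) ->
  (a <= n)%N ->
  shsum s F = \sum_(u : 'S_n | shuffle_at a u)
    (-1) ^+ u *: F (take a [seq nth x0 s (u i) | i <- enum 'I_n])
                   (drop a [seq nth x0 s (u i) | i <- enum 'I_n]).
Proof.
elim: n s a F => [|n IH] [|x s] a F //= => [_|[szs]] F0 lean.
  have -> : a = 0%N by lia.
  rewrite (big_pred1 1%g) => [|u]; last first.
    apply/shuffle_atP/eqP => [_|_ []//]; apply/permP=> -[] //.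
  rewrite odd_perm1 scale1r.
  have -> : enum 'I_0 = [::] by apply: size0nil; rewrite size_enum_ord.
  by [].
rewrite (reindex (fun p : 'I_n.+1 * 'S_n => lift_perm p.1 ord0 p.2)); last first.
  exact: onW_bij (lift_perm0_bij n).
pose T (k : 'I_n.+1) := \sum_(u : 'S_n | shuffle_at a (lift_perm k ord0 u))
  (-1) ^+ lift_perm k ord0 u *:
  F (take a [seq nth x0 (x :: s) (lift_perm k ord0 u i) | i <- enum 'I_n.+1])
    (drop a [seq nth x0 (x :: s) (lift_perm k ord0 u i) | i <- enum 'I_n.+1]).
rewrite [RHS](_ : _ = \sum_k T k); last by rewrite pair_big_dep.
have liftE (k : 'I_n.+1) (u : 'S_n) :
    [seq nth x0 (x :: s) (lift_perm k ord0 u i) | i <- enum 'I_n.+1] =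
    take k [seq nth x0 s (u i) | i <- enum 'I_n]
    ++ x :: drop k [seq nth x0 s (u i) | i <- enum 'I_n].
  rewrite (map_enum_lift (k := k) (f' := fun i : 'I_n => nth x0 s (u i))).
    by rewrite lift_perm_id.
  by move=> i; rewrite lift_perm_lift.
(* The value 0 heads the second block, behind the a letters of the first, which accounts for the
   sign. *)
have Ta (k : 'I_n.+1) : k = a :> nat ->
    T k = shsum s (fun A B => (-1) ^+ size A *: F A (x :: B)).
  move=> ka; rewrite (IH _ a) //; last by rewrite -ka -ltnS.
    rewrite /T (eq_bigl _ _ (fun u => shuffle_at_lift u ka)).
    apply: eq_bigr => u _; rewrite liftE ka.
    have sza : size (take a [seq nth x0 s (u i) | i <- enum 'I_n]) = a.
      by rewrite size_takel // size_map size_enum_ord -ka -ltnS.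
    rewrite take_size_cat // drop_size_cat // sza scalerA; congr (_ *: _).
    by rewrite odd_lift_perm ka addbF signr_addb signr_odd mulrC.
  by move=> A B szA; rewrite F0 // scaler0.
(* For a = 0 the positions 0 and a coincide, and the summand of [shsum] with x in A vanishes, its
   first block being nonempty. *)
case: a F0 lean @T Ta => [|a] F0 lean T Ta.
  rewrite big_ord_recl big1 ?addr0 => [|k _].
    rewrite Ta // [X in X + _](_ : _ = 0) ?add0r //.
    by apply: shsum_eq0 => A B _; apply: F0.
  by apply: big_pred0 => u; apply: shuffle_at_lift_neq.
rewrite (bigD1 ord0) //=; congr (_ + _).
  rewrite (IH _ a) // => [|A B szA]; last by apply: F0 => -[].
  rewrite /T (eq_bigl _ _ (fun u => shuffle_at_lift0 a u)).
  apply: eq_bigr => u _; rewrite liftE take0 drop0 /=; congr (_ *: _).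
  by rewrite odd_lift_perm.
have [lean'|ltna] := leqP a.+1 n.
  rewrite (bigD1 (Ordinal (lean' : (a.+1 < n.+1)%N))) //= Ta //.
  rewrite big1 ?addr0 // => k /andP[k0 ka].
  apply: big_pred0 => u; apply: shuffle_at_lift_neq => // ka'.
  by case/eqP: ka; apply: val_inj.
rewrite big1 => [|k k0].
  apply: etrans (shsum0 _ s); apply: eq_shsum_size => A B szAB.
  by rewrite F0 ?scaler0 //; lia.
apply: big_pred0 => u; apply: shuffle_at_lift_neq => // ka.
by have := ltn_ord k; lia.
Qed.

(** * Cochains as functions of lists *)

Section Evaluation.
Variables (K : fieldType) (V W : lmodType K).

(** The default 0 off the arity lets sums over all splittings select the right block sizes, and
    makes maps of provably equal arities comparable without casts. *)
Definition ev n (P : nmap n V W) (s : seq V) : W :=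
  if size s == n then P (fun i => nth 0 s i) else 0.

Lemma homog_ev n (P : nmap n V W) s : size s <> n -> ev P s = 0.
Proof. by rewrite /ev => /eqP/negPf ->. Qed.

Lemma ev_map_enum n (P : nmap n V W) (l : 'I_n -> V) :
  ev P [seq l i | i <- enum 'I_n] = P l.
Proof.
rewrite /ev size_map size_enum_ord eqxx; congr P; apply: funext => i.
by rewrite (nth_map i) ?size_enum_ord // nth_ord_enum.
Qed.

Lemma ev_inj n : injective (@ev n).
Proof. by move=> P Q eqPQ; apply: funext => l; rewrite -!ev_map_enum eqPQ. Qed.

Lemma evD n (P Q : nmap n V W) s : ev (P + Q) s = ev P s + ev Q s.
Proof. by rewrite /ev; case: ifP; rewrite ?addr0. Qed.

Lemma evZ n a (P : nmap n V W) s : ev (a *: P) s = a *: ev P s.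
Proof. by rewrite /ev; case: ifP; rewrite ?scaler0. Qed.

Lemma ev0 n s : ev (0 : nmap n V W) s = 0.
Proof. by rewrite /ev; case: ifP. Qed.

Lemma skew_perm (f : seq V -> W) n (l : 'I_n -> V) (u : 'S_n) : skewml f ->
  f [seq l (u i) | i <- enum 'I_n] = (-1) ^+ u *: f [seq l i | i <- enum 'I_n].
Proof.
elim: n l u f => [|n IH] l u f sf.
  rewrite (_ : u = 1%g) ?odd_perm1 ?scale1r; last by apply/permP => -[].
  by congr f; apply: eq_map => -[].
have [[k' u'] /= def_u] : exists p : 'I_n.+1 * 'S_n, lift_perm p.1 ord0 p.2 = u.
  by case: (lift_perm0_bij n) => g _ gK; exists (g u); rewrite gK.
rewrite -def_u (map_enum_lift (k := k')
  (f' := fun i : 'I_n => l (lift ord0 (u' i)))).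
  rewrite lift_perm_id (skew_move _ _ _ sf) cat_take_drop.
  have /= -> := IH (fun i : 'I_n => l (lift ord0 i)) u' _ (skew_cons (l ord0) sf).
  rewrite size_takel; last first.
    by rewrite size_map size_enum_ord -ltnS.
  rewrite (map_enum_lift (f := l) (k := ord0)
    (f' := fun i : 'I_n => l (lift ord0 i))) //.
  rewrite take0 drop0 scalerA odd_lift_perm /= addbF signr_addb signr_odd.
  by [].
by move=> i; rewrite lift_perm_lift.
Qed.

Lemma upd_enum n (l : 'I_n -> V) (i : 'I_n) (x : V) :
  [seq upd l i x j | j <- enum 'I_n] =
  take i [seq l j | j <- enum 'I_n] ++ x :: drop i.+1 [seq l j | j <- enum 'I_n].
Proof.
have szl : size [seq l j | j <- enum 'I_n] = n by rewrite size_map size_enum_ord.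
apply: (@eq_from_nth _ 0) => [|j].
  rewrite size_cat /= size_drop size_takel szl; last exact: ltnW.
  by rewrite size_map size_enum_ord; have := ltn_ord i; lia.
rewrite size_map size_enum_ord => ltjn; rewrite (nth_map i) ?size_enum_ord //.
have -> : nth i (enum 'I_n) j = Ordinal ltjn.
  by apply: val_inj; rewrite /= nth_enum_ord.
rewrite /upd nth_cat size_takel ?szl; last exact: ltnW.
have [ltji|leij] := ltnP j i.
  rewrite nth_take // (nth_map i) ?size_enum_ord // ifN; last first.
    by apply/eqP => /(congr1 val) /=; lia.
  by congr l; apply: val_inj; rewrite /= nth_enum_ord.
case: (j - i)%N (subnK leij) => [|d] /= def_j.
  by rewrite ifT //; apply/eqP/val_inj.
rewrite nth_drop ifN; last by apply/eqP => /(congr1 val) /=; lia.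
have -> : (i.+1 + d)%N = j by lia.
rewrite (nth_map i) ?size_enum_ord //.
by congr l; apply: val_inj; rewrite /= nth_enum_ord.
Qed.

Lemma cochainP n (P : nmap n V W) : cochain P <-> skewml (ev P).
Proof.
split=> [[mP sP]|sP].
  split=> [s1 s2 a x y|s1 s2 x y].
    rewrite /ev !size_cat /=; case: eqP => [szs|]; last by rewrite scaler0 addr0.
    have lti : (size s1 < n)%N by lia.
    have updE z : (fun i : 'I_n => nth 0 (s1 ++ z :: s2) i) =
        upd (fun i => nth 0 (s1 ++ 0 :: s2) i) (Ordinal lti) z.
      apply: funext => i; rewrite /upd !nth_cat; case: eqP => [->|ni] /=.
        by rewrite ltnn subnn.
      case: ltnP => // lei; case: (i - _)%N (subnK lei) => // eqi.
      by case: ni; apply: val_inj.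
    by rewrite (updE (a *: x + y)) (updE x) (updE y) mP.
  rewrite /ev !size_cat /=; case: eqP => [szs|]; last by rewrite oppr0.
  have lti : (size s1 < n)%N by lia.
  have ltj : ((size s1).+1 < n)%N by lia.
  have ij : Ordinal lti != Ordinal ltj by apply/eqP => /(congr1 val) /=; lia.
  rewrite -[RHS]scaleN1r.
  have := sP (fun i => nth 0 (s1 ++ y :: x :: s2) i)
    (tperm (Ordinal lti) (Ordinal ltj)).
  rewrite odd_tperm ij expr1 => <-; congr P; apply: funext => i; rewrite !nth_cat.
  case: tpermP => [->|->|ni nj] /=; rewrite ?ltnn ?subnn //.
    by rewrite !ltnNge leqnSn /= subSnn.
    by rewrite !ltnNge leqnSn /= subSnn.
  case: ltnP => // lei; case: (i - _)%N (subnK lei) => [|[|d]] // eqi.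
    by case: ni; apply: val_inj.
  by case: nj; apply: val_inj.
split=> [l i a x y|l u].
  by rewrite -!ev_map_enum !upd_enum (proj1 sP).
by rewrite -!ev_map_enum skew_perm.
Qed.

End Evaluation.

(** * The Nijenhuis-Richardson bracket *)

Section NijenhuisRichardson.
Variables (K : fieldType) (V : lmodType K).

(** [shsum_shuffles] applies because Q is linear in its first slot: on a block of size other than a,
    [ev P] is 0 and therefore so is the term. *)
Lemma ev_insertion a b (P : nmap a V V) (Q : nmap b.+1 V V) (s : seq V) :
  cochain Q -> ev (insertion P Q) s = ins (ev P) (ev Q) s.
Proof.
move=> /cochainP sQ; have [szs|/eqP szs] := eqVneq (size s) (a + b)%N; last first.
  rewrite homog_ev // (homog_ins sQ _ _ szs) //; exact: homog_ev.
rewrite /ins (shsum_shuffles (n := (a + b)%N) (a := a) 0) //; last 2 first.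
- by move=> A B szA; rewrite (homog_ev _ szA) (linear_fun0 (skew_lin B sQ)).
- exact: leq_addr.
rewrite {1}/ev szs eqxx /insertion; apply: eq_big => [u|u _].
  exact: shuffle_atE.
congr (_ *: _); set w := [seq _ | _ <- _].
have szw : size w = (a + b)%N by rewrite size_map size_enum_ord.
have nthw (i : 'I_(a + b)) : nth 0 w i = nth 0 s (u i).
  by rewrite (nth_map i) ?size_enum_ord // nth_ord_enum.
rewrite /ev /= size_drop szw addKn eqxx; congr Q; apply: funext => t.
case: (unliftP ord0 t) => [t'|] -> /=.
  by rewrite nth_drop -nthw.
rewrite size_takel ?szw ?leq_addr // eqxx; congr P; apply: funext => i.
by rewrite nth_take // -nthw.
Qed.

Lemma ev_nr_br p q (P : nmap p.+1 V V) (Q : nmap q.+1 V V) :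
  cochain P -> cochain Q -> ev (nr_br P Q) = gbr p q (ev P) (ev Q).
Proof.
move=> cP cQ; apply: funext => s.
rewrite /gbr -(ev_insertion P s cQ) -(ev_insertion Q s cP) /ev.
have -> : (size s == (q.+1 + p)%N) = (size s == (p + q).+1) by congr (_ == _); lia.
case: eqP => // _; by rewrite scaler0 subr0.
Qed.

Lemma cochain_nr_br p q (P : nmap p.+1 V V) (Q : nmap q.+1 V V) :
  cochain P -> cochain Q -> cochain (nr_br P Q).
Proof.
move=> cP cQ; apply/cochainP; rewrite ev_nr_br //.
by apply: skew_gbr; apply/cochainP.
Qed.

Lemma ev_ecast i j (e : i = j) (P : nmap i.+1 V V) :
  ev (ecast k (nmap k.+1 V V) e P) = ev P.
Proof. by case: j / e. Qed.

Lemma nr_brC p q (P : nmap p.+1 V V) (Q : nmap q.+1 V V) :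
  cochain P -> cochain Q ->
  nr_br P Q =
  - ((-1) ^+ (p * q)%N *: ecast k (nmap k.+1 V V) (addnC q p) (nr_br Q P)).
Proof.
move=> cP cQ; apply: ev_inj; apply: funext => s.
by rewrite -scaleNr evZ ev_ecast !ev_nr_br // gbrC scaleNr.
Qed.

Lemma nr_br_jacobi p q r
    (P : nmap p.+1 V V) (Q : nmap q.+1 V V) (R : nmap r.+1 V V) :
  cochain P -> cochain Q -> cochain R ->
  nr_br P (nr_br Q R) =
    ecast k (nmap k.+1 V V) (esym (addnA p q r)) (nr_br (nr_br P Q) R)
    + (-1) ^+ (p * q)%N
      *: ecast k (nmap k.+1 V V) (esym (addnCA p q r)) (nr_br Q (nr_br P R)).
Proof.
move=> cP cQ cR; apply: ev_inj; apply: funext => s.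
rewrite evD evZ !ev_ecast !ev_nr_br //; try exact: cochain_nr_br.
by apply: gbr_jacobi; try exact/cochainP; apply: homog_ev.
Qed.

Lemma nr_br_linearr p q (P : nmap p.+1 V V) a (Q R : nmap q.+1 V V) :
  cochain P -> cochain Q -> cochain R -> cochain (a *: Q + R) ->
  nr_br P (a *: Q + R) = a *: nr_br P Q + nr_br P R.
Proof.
move=> cP cQ cR cQR; apply: ev_inj; apply: funext => s.
rewrite [RHS]evD [X in _ = X + _]evZ !ev_nr_br //.
apply: gbr_linearr; first exact/cochainP.
by move=> t; rewrite evD evZ.
Qed.

Lemma nr_br_linearl p q (P : nmap p.+1 V V) a (Q R : nmap q.+1 V V) :
  cochain P -> cochain Q -> cochain R -> cochain (a *: Q + R) ->
  nr_br (a *: Q + R) P = a *: nr_br Q P + nr_br R P.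
Proof.
move=> cP cQ cR cQR; apply: ev_inj; apply: funext => s.
rewrite [RHS]evD [X in _ = X + _]evZ !ev_nr_br //.
apply: gbr_linearl; first exact/cochainP.
by move=> t; rewrite evD evZ.
Qed.

Lemma cochain_submodule n (U W : lmodType K) : is_submodule (@cochain K n U W).
Proof.
split; first by apply/cochainP; split=> *; rewrite !ev0 ?scaler0 ?addr0 ?oppr0.
move=> a P Q /cochainP sP /cochainP sQ; apply/cochainP.
rewrite (_ : ev _ = fun s => a *: ev P s + ev Q s).
  by apply: skewD => //; apply: skewZ.
by apply: funext => s; rewrite evD evZ.
Qed.

(** The axioms on D are instances of the Jacobi identity with mu. Here mu ranges over all cochains
    rather than over [part], because the Lie brackets to be used have values outside h. *)
Lemma nr_dgLa (part : forall k, set (nmap k.+1 V V)) (mu : nmap 2 V V)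
    (D : forall k, nmap k.+1 V V -> nmap k.+2 V V) :
    (2%:R : K) != 0 -> cochain mu -> nr_br mu mu = 0 ->
    (forall k, is_submodule (part k)) ->
    (forall k P, part k P -> cochain P) ->
    (forall p q P Q, part p P -> part q Q -> part (p + q)%N (nr_br P Q)) ->
    (forall k P, part k P -> D k P = nr_br (p := 1) mu P) ->
    (forall k P, part k P -> part k.+1 (D k P)) ->
  is_dgLa (@DgLaData K (fun k => nmap k.+1 V V) part
    (fun p q P Q => nr_br P Q) D).
Proof.
move=> nz2 cmu mumu subp pc brp DE Dp; split=> //=.
- move=> i j Q pQ a P P' pP pP'; apply: nr_br_linearl; eauto.
  exact: (pc _ _ (proj2 (subp i) _ _ _ pP pP')).
- move=> i j P pP a Q Q' pQ pQ'; apply: nr_br_linearr; eauto.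
  exact: (pc _ _ (proj2 (subp j) _ _ _ pQ pQ')).
- move=> i j P Q pP pQ; apply: nr_brC; eauto.
- move=> i j k P Q R pP pQ pR; apply: nr_br_jacobi; eauto.
- move=> k a P Q pP pQ; have pPQ := proj2 (subp k) a _ _ pP pQ.
  by rewrite !DE //; apply: (@nr_br_linearr 1 k); eauto.
- move=> k P pP; have cP := pc _ _ pP.
  rewrite (DE _ _ (Dp _ _ pP)) DE //; apply: (@ev_inj _ _ _ (1 + (1 + k)).+1).
  apply: funext => s; rewrite ev0 !ev_nr_br //; last exact: cochain_nr_br.
  have [smu sP] := (iffLR (cochainP mu) cmu, iffLR (cochainP P) cP).
  (* With y = [mu, [mu, P]], the Jacobi identity reads y = [[mu, mu], P] - y, so 2 y = 0. *)
  have := gbr_jacobi s smu smu sP (@homog_ev _ _ _ _ mu) (@homog_ev _ _ _ _ mu)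
    (@homog_ev _ _ _ _ P).
  set y := gbr 1 (1 + k) _ _ s.
  have -> : gbr (1 + 1) k (gbr 1 1 (ev mu) (ev mu)) (ev P) s = 0.
    have ev00 t : ev (0 : nmap 3 V V) t =
        -1 *: ev (0 : nmap 3 V V) t + ev (0 : nmap 3 V V) t.
      by rewrite !ev0 scaler0 addr0.
    by rewrite -ev_nr_br // mumu (gbr_linearl _ _ s sP ev00) scaleN1r addNr.
  rewrite muln1 expr1 scaleN1r add0r => yN.
  have : 2%:R *: y = 0 by rewrite scaler_nat mulr2n {2}yN subrr.
  by move/eqP; rewrite scaler_eq0 (negPf nz2) => /eqP.
move=> i j P Q pP pQ; have [cP cQ] := (pc _ _ pP, pc _ _ pQ).
rewrite !DE //; last exact: brp.
apply: (@ev_inj _ _ _ (1 + (i + j)).+1); apply: funext => s.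
rewrite [RHS]evD [X in _ = _ + X]evZ ev_ecast.
have [cmP cmQ] := (cochain_nr_br cmu cP, cochain_nr_br cmu cQ).
rewrite (ev_nr_br cmu (cochain_nr_br cP cQ)) (ev_nr_br cP cQ).
rewrite (ev_nr_br cmP cQ) (ev_nr_br cP cmQ) (ev_nr_br cmu cP) (ev_nr_br cmu cQ).
(* The Leibniz rule is the Jacobi identity for (mu, P, Q), mu having degree 1. *)
rewrite (gbr_jacobi s _ _ _ (@homog_ev _ _ _ _ mu) (@homog_ev _ _ _ _ P)
    (@homog_ev _ _ _ _ Q)) ?mul1n //; exact/cochainP.
Qed.

End NijenhuisRichardson.

(** * The components of C_>(g + h, h) *)

Section SmallShuffles.
Variables (K : fieldType) (V W : lmodType K).
Implicit Types (s A B : seq V) (F : seq V -> seq V -> W).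

Lemma shsum_nil s F :
  (forall A B, size A <> 0%N -> F A B = 0) -> shsum s F = F [::] s.
Proof.
elim: s F => [|x s IH] F F0 //=; rewrite IH => [|A B _]; last exact: F0.
rewrite F0 // add0r IH ?scale1r // => A B szA.
by rewrite F0 ?scaler0.
Qed.

Definition del (T : Type) i (s : seq T) := take i s ++ drop i.+1 s.

Lemma shsum_one n s F : size s = n ->
  (forall A B, size A <> 1%N -> F A B = 0) ->
  shsum s F = \sum_(i < n) (-1) ^+ i *: F [:: s`_i] (del i s).
Proof.
elim: s n F => [|x s IH] n F <- F0 /=; first by rewrite big_ord0 F0.
have del0 : del 0 (x :: s) = s by rewrite /del /= drop0.
rewrite big_ord_recl /= scale1r del0 shsum_nil; last first.
  by move=> A B szA; rewrite F0 //= => -[].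
congr (_ + _); rewrite (IH _ _ erefl) => [|A B szA]; last first.
  by rewrite F0 ?scaler0.
apply: eq_bigr => i _; by rewrite scalerA /= -exprD addn1.
Qed.

(** Bringing s_i and s_j to the front, s_i passes i letters and s_j passes j - 1 others; this is the
    sign of the second Chevalley-Eilenberg sum. *)
Lemma shsum_two n s F : size s = n ->
  (forall A B, size A <> 2%N -> F A B = 0) ->
  shsum s F = \sum_(i < n) \sum_(j < n | (i < j)%N)
    (-1) ^+ (i + j).+1 *: F [:: s`_i; s`_j] (del i (del j s)).
Proof.
elim: s n F => [|x s IH] n F <- F0 /=; first by rewrite big_ord0 F0.
rewrite big_ord_recl big_mkcond big_ord_recl /= add0r; congr (_ + _).
  rewrite (shsum_one erefl) => [|A B szA]; last by rewrite F0 //= => -[].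
  apply: eq_bigr => i _; rewrite /= /bump leq0n !add1n add0n !exprS.
  by rewrite !mulN1r opprK /del /= drop0.
rewrite (IH _ _ erefl) => [|A B szA]; last by rewrite F0 ?scaler0.
apply: eq_bigr => i _; rewrite [RHS]big_mkcond big_ord_recl /= add0r.
rewrite [LHS]big_mkcond; apply: eq_bigr => j _.
rewrite /= /bump !leq0n !add1n ltnS; case: ifP => // _.
rewrite scalerA -exprD; congr (_ ^+ _ *: _); lia.
Qed.

Lemma nth_del i s j : nth 0 (del i s) j = nth 0 s (bump i j).
Proof.
rewrite /del nth_cat size_take_min.
have [lis|lsi] := ltnP i (size s).
  case: ltnP => [ji|ij].
    by rewrite nth_take // /bump leqNgt ji.
  by rewrite nth_drop /bump ij; congr nth; lia.
rewrite drop_oversize ?take_oversize ?nth_nil //; last by lia.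
case: ltnP => [js|sj]; first by rewrite /bump leqNgt (leq_trans js).
by rewrite nth_default //; apply: leq_trans sj (leq_addl _ _).
Qed.

Lemma shsum_sum (I : Type) (r : seq I) (p : pred I) s
    (F : I -> seq V -> seq V -> W) :
  shsum s (fun A B => \sum_(i <- r | p i) F i A B) =
  \sum_(i <- r | p i) shsum s (F i).
Proof.
elim: r => [|i r IH].
  rewrite big_nil -[RHS](shsum0 W s); apply: eq_shsum_fun => A B.
  by rewrite big_nil.
rewrite big_cons -IH; case: ifP => pi; rewrite -?shsumD;
  by apply: eq_shsum_fun => A B; rewrite big_cons pi.
Qed.

End SmallShuffles.

Lemma map_nth_enum (T : Type) (x0 : T) n (s : seq T) : size s = n ->
  [seq nth x0 s i | i : 'I_n <- enum 'I_n] = s.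
Proof.
move=> szs.
transitivity (map (nth x0 s) (map val (enum 'I_n))); first by rewrite -map_comp.
by rewrite val_enum_ord -szs; apply: mkseq_nth.
Qed.

Definition unev (K : fieldType) (V W : lmodType K) n (f : seq V -> W) :
  nmap n V W := fun l => f [seq l i | i <- enum 'I_n].

Lemma ev_unev (K : fieldType) (V W : lmodType K) n (f : seq V -> W) :
  (forall s, size s <> n -> f s = 0) -> ev (unev f : nmap n V W) = f.
Proof.
move=> hf; apply: funext => s; rewrite /ev; case: eqP => [szs|/hf //].
by rewrite /unev map_nth_enum.
Qed.

Section Components.
Variables (K : fieldType) (g h : lmodType K).
Notation V := ((g * h)%type : lmodType K).

Definition toL (x : V) : V := (x.1, 0).
Definition toR (x : V) : V := (0, x.2).

Lemma toL_linear : linear toL.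
Proof. by move=> a x y; apply/eqP; rewrite xpair_eqE /= scaler0 addr0 !eqxx. Qed.

Lemma toR_linear : linear toR.
Proof. by move=> a x y; apply/eqP; rewrite xpair_eqE /= scaler0 addr0 !eqxx. Qed.

Lemma skew_map (f : seq V -> V) (t : V -> V) :
  linear t -> skewml f -> skewml (fun s => f (map t s)).
Proof.
move=> lt [lf sf]; split=> [s1 s2 a x y|s1 s2 x y]; rewrite !map_cat /=.
  by rewrite lt; apply: lf.
exact: sf.
Qed.

Lemma skew_catl (f : seq V -> V) s : skewml f -> skewml (fun t => f (s ++ t)).
Proof.
by move=> [lf sf]; split=> [s1 s2 a x y|s1 s2 x y]; rewrite !catA;
  [apply: lf|apply: sf].
Qed.

Lemma skew_catr (f : seq V -> V) s : skewml f -> skewml (fun t => f (t ++ s)).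
Proof.
by move=> [lf sf]; split=> [s1 s2 a x y|s1 s2 x y]; rewrite -!catA;
  [apply: lf|apply: sf].
Qed.

Lemma skew_zero (f : seq V -> V) s : skewml f -> 0 \in s -> f s = 0.
Proof.
move=> sf /path.splitPr[s1 s2]; rewrite (skew_move _ _ _ sf).
by rewrite (linear_fun0 (skew_lin _ sf)) scaler0.
Qed.

(** Multilinear expansion along x = [toL x] + [toR x], with the g-parts sorted to the front: the
    exterior algebra of g + h as the tensor product of those of g and h. *)
Lemma shsum_expand (f : seq V -> V) s : skewml f ->
  shsum s (fun A B => f (map toL A ++ map toR B)) = f s.
Proof.
elim: s f => [|x s IH] f sf //=.
rewrite (IH (fun s => f (toL x :: s))); last exact: skew_cons.
under [X in _ + X]eq_shsum_fun => A B.
  rewrite (skew_move _ _ _ sf) size_map scalerA -expr2 sqrr_sign scale1r; over.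
rewrite (IH (fun s => f (toR x :: s))); last exact: skew_cons.
have := skew_lin s sf 1 (toL x) (toR x); rewrite !scale1r => <-.
by case: x => a b; congr (f (_ :: s)); rewrite /toL /toR /=;
  apply/eqP; rewrite xpair_eqE /= addr0 add0r !eqxx.
Qed.

(** The intrinsic form of C_> (see [Cgt_partP]): vanishing on arguments in h excludes the component
    m = 0. *)
Definition vertical n (P : nmap n V V) :=
  [/\ cochain P, forall s, (ev P s).1 = 0
    & forall s, all (fun x : V => x.1 == 0) s -> ev P s = 0].

Lemma vertical_submodule n : is_submodule [set P : nmap n V V | vertical P].
Proof.
have [c0 cD] := cochain_submodule n V V.
split=> [|a P Q [cP P1 P0] [cQ Q1 Q0]].
  by split=> // *; rewrite ev0.
split=> [|s|s s0]; rewrite ?evD ?evZ /=; first exact: cD.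
  by rewrite P1 Q1 scaler0 addr0.
by rewrite P0 // Q0 // scaler0 addr0.
Qed.

(** The terms of [shsum_expand] with m arguments projected to g, that is, the part of P in C^{m, n -
    m}. *)
Definition component n (P : nmap n V V) m : nmap n V V :=
  unev (fun s => shsum s (fun A B =>
    if size A == m then ev P (map toL A ++ map toR B) else 0)).

Lemma ev_component n (P : nmap n V V) m s :
  ev (component P m) s = shsum s (fun A B =>
    if size A == m then ev P (map toL A ++ map toR B) else 0).
Proof.
rewrite ev_unev // => t szt; rewrite -[RHS](shsum0 V t).
apply: eq_shsum_size => A B szAB; case: eqP => // _.
by apply: homog_ev; rewrite size_cat !size_map szAB.
Qed.

Lemma bicochain_component n (P : nmap n V V) m :
  vertical P -> bicochain m (component P m).
Proof.
case=> /cochainP sP P1 P0; split.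
- apply/cochainP; rewrite (funext (ev_component P m)); apply: skew_shsum => [B|A].
    split=> [s1 s2 a x y|s1 s2 x y]; rewrite !size_cat /=.
      case: ifP => _; last by rewrite scaler0 addr0.
      exact: (proj1 (skew_map toL_linear (skew_catr (map toR B) sP))).
    case: ifP => _; last by rewrite oppr0.
    exact: (proj2 (skew_map toL_linear (skew_catr (map toR B) sP))).
  case: (size A == m); last by split=> *; rewrite ?scaler0 ?addr0 ?oppr0.
  exact: (skew_map toR_linear (skew_catl (map toL A) sP)).
- move=> l; rewrite /component /unev (@linear_shsum _ _ _ _ fst) //.
  by apply: shsum_eq0 => A B _; case: ifP.
move=> S l lS Sm; rewrite /component /unev; set s := [seq _ | _ <- _].
apply: shsum_eq0 => A B pAB; case: eqP => // szA; apply: (skew_zero sP).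
have szs : size s = n by rewrite size_map size_enum_ord.
have count_le (p : pred V) (D : {set 'I_n}) :
    (forall i, p (l i) -> i \in D) -> (count p s <= #|D|)%N.
  move=> pD; rewrite count_map cardE {2}/enum_mem size_filter enumT.
  by apply: sub_count => i /=; apply: pD.
have count1 : (count (fun x : V => x.1 != 0%R) s <= #|S|)%N.
  apply: count_le => i; apply: contraR => iS.
  by have := lS i; rewrite (negPf iS) => ->.
have count2 : (count (fun x : V => x.2 != 0%R) s <= #|~: S|)%N.
  apply: count_le => i; rewrite inE; apply: contra => iS.
  by have := lS i; rewrite iS => ->.
(* If no projected argument is 0, then A has at most [#|S|] letters and B at most as many as the
   complement of S. These bounds add up to n, so A has exactly [#|S|] letters, against [Sm]. *)
case: (boolP (0 \in map toL A ++ map toR B)) => //.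
rewrite mem_cat negb_or => /andP[A0 B0]; exfalso; apply: Sm.
have countA : count (fun x : V => x.1 != 0) A = size A.
  apply/eqP; rewrite -all_count; apply/allP => x xA; apply: contra A0 => /eqP x0.
  by apply/mapP; exists x; rewrite // /toL x0.
have countB : count (fun x : V => x.2 != 0) B = size B.
  apply/eqP; rewrite -all_count; apply/allP => x xB; apply: contra B0 => /eqP x0.
  by apply/mapP; exists x; rewrite // /toR x0.
have /seq.permP countAB := pAB.
move: count1 count2; rewrite -!countAB !count_cat countA countB => count1 count2.
have leA : (size A <= #|S|)%N := leq_trans (leq_addr _ _) count1.
have leB : (size B <= #|~: S|)%N := leq_trans (leq_addl _ _) count2.
apply/eqP; rewrite eqn_leq -{2}szA leA andbT -(leq_add2r #|~: S|) cardsC card_ord.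
apply: leq_trans (_ : (size A + size B)%N <= _)%N; last by rewrite szA leq_add2l.
by rewrite -size_cat (perm_size pAB) szs.
Qed.

Lemma Cgt_partP k (P : nmap k.+1 V V) : Cgt_part P <-> vertical P.
Proof.
split=> [[c [cB ->]]|vP].
  have [v0 vD] := vertical_submodule k.+1.
  rewrite big_nat; elim/big_ind: _ => [|Q R vQ vR|m mk] //.
    by rewrite -[Q]scale1r; apply: vD.
  have [cc c1 c0] := cB m mk.
  split=> // s.
    by rewrite /ev; case: ifP.
  move=> s0; rewrite /ev; case: eqP => // szs.
  apply: (c0 finset.set0) => [i|]; last by rewrite cards0; lia.
  by rewrite inE; apply/eqP/(all_nthP 0 s0); rewrite szs.
exists (component P); split=> [m _|]; first exact: bicochain_component.
have [/cochainP sP P1 P0] := vP.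
apply: ev_inj; apply: funext => s.
rewrite (big_morph (fun Q => ev Q s) (fun Q R => evD Q R s) (ev0 _ _ s)).
under eq_bigr do rewrite ev_component.
rewrite -shsum_sum -[LHS](shsum_expand _ sP).
have [szs|/eqP szs] := eqVneq (size s) k.+1; last first.
  apply: eq_shsum_size => A B szAB.
  have ev00 : ev P (map toL A ++ map toR B) = 0.
    by apply: homog_ev; rewrite size_cat !size_map szAB.
  by rewrite ev00 big1 // => m _; case: ifP.
apply: eq_shsum_size => A B szAB; rewrite -big_mkcond /=.
rewrite (eq_bigl (fun m => m == size A)) => [|m]; last by rewrite eq_sym.
(* Each splitting occurs only in the component m = [size A]; an empty A, absent from the sum,
   contributes 0 because all arguments then lie in h. *)
rewrite big_nat1_eq; case: A szAB => [|x A] szAB /=.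
  by apply: P0; rewrite all_map; apply/allP => b _ /=; apply: eqxx.
by rewrite ltnS ifT // -szs -szAB leq_addr.
Qed.

End Components.

(** * Semidirect products and the Chevalley-Eilenberg complex *)

Section LieCochain.
Variables (K : fieldType) (V : lmodType K) (b : V -> V -> V).
Hypothesis b_lie : is_lie_bracket b.

Lemma lie_anti x y : b x y = - b y x.
Proof.
apply/eqP; rewrite -addr_eq0; apply/eqP.
have bD u v w : b u (v + w) = b u v + b u w.
  by have := lie_linearr b_lie u 1 v w; rewrite !scale1r.
have Db u v w : b (v + w) u = b v u + b w u.
  by have := lie_linearl b_lie u 1 v w; rewrite !scale1r.
have := lie_alt b_lie (x + y).
by rewrite bD !Db !(lie_alt b_lie) add0r addr0 addrC.
Qed.

Lemma cochain_br_cochain : cochain (br_cochain b).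
Proof.
apply/cochainP; split=> [s1 s2 a x y|s1 s2 x y].
  case: s1 => [|z [|z' s1]]; case: s2 => [|t [|t' s2]];
    rewrite /ev /= ?size_cat /= ?addnS ?scaler0 ?addr0 //.
    exact: (lie_linearl b_lie t).
  exact: (lie_linearr b_lie z).
case: s1 => [|z s1]; case: s2 => [|t s2];
  rewrite /ev /= ?size_cat /= ?addnS ?oppr0 //.
exact: lie_anti.
Qed.

(** On three arguments, b inserted into itself is minus the Jacobi expression; on other lists it is
    0 by arity. *)
Lemma nr_br_lie : nr_br (br_cochain b) (br_cochain b) = 0.
Proof.
have cb := cochain_br_cochain; apply: ev_inj; apply: funext => s.
have sb := iffLR (cochainP _) cb.
have insbb : ins (ev (br_cochain b)) (ev (br_cochain b)) s = 0.
  have [szs|/eqP szs] := eqVneq (size s) 3%N; last first.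
    exact: (@homog_ins K V 2 1 _ _ sb (@homog_ev _ _ _ _ _) (@homog_ev _ _ _ _ _)).
  case: s szs => [|x [|y [|z [|]]]] // _.
  have b0 w : b 0 w = 0 := linear_fun0 (lie_linearl b_lie w).
  rewrite /ins /ev /= /br_cochain /= ?b0 ?scaler0 ?addr0 ?add0r.
  rewrite expr0 scale1r expr1 scaleN1r -signr_odd expr0 scale1r.
  rewrite (lie_anti (b x y) z) (lie_anti (b x z) y) (lie_anti (b y z) x) opprK.
  rewrite (lie_anti x z) (linear_funN _ (lie_linearr b_lie y)).
  rewrite -!opprD -[RHS]oppr0 -(lie_jacobi b_lie x y z); congr (- _).
  by rewrite addrC [X in _ + X]addrC addrA.
by rewrite ev0 ev_nr_br // /gbr insbb scaler0 subr0.
Qed.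

End LieCochain.

Section Semidirect.
Variables (K : fieldType) (g H : lmodType K) (br : g -> g -> g).
Notation V := ((g * H)%type : lmodType K).

Definition semidirect_br (act : g -> H -> H) (x y : V) : V :=
  (br x.1 y.1, act x.1 y.2 - act y.1 x.2).

Lemma semidirect_lie act : is_lie_bracket br -> is_lie_action br act ->
  is_lie_bracket (semidirect_br act).
Proof.
move=> lbr lact.
have pairP (x y : V) : x.1 = y.1 -> x.2 = y.2 -> x = y.
  by case: x => ? ?; case: y => ? ? /= -> ->.
have aN x h : act x (- h) = - act x h by exact: (linear_funN _ (act_linearr lact x)).
have aD x h h' : act x (h + h') = act x h + act x h'.
  by have := act_linearr lact x 1 h h'; rewrite !scale1r.
split.
- move=> y a x x'; apply: pairP => /=; first exact: (lie_linearl lbr).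
  rewrite (act_linearl lact) (act_linearr lact) scalerDr scalerN opprD.
  by rewrite addrACA.
- move=> y a x x'; apply: pairP => /=; first exact: (lie_linearr lbr).
  rewrite (act_linearl lact) (act_linearr lact) scalerDr scalerN opprD.
  by rewrite addrACA.
- by move=> x; apply: pairP => /=; rewrite ?(lie_alt lbr) ?subrr.
move=> x y z; apply: pairP => /=; first exact: (lie_jacobi lbr).
rewrite !(act_br lact) !aD !aN !opprD !opprK.
rewrite !addrA (ACl ((1*11)*(8*2)*(5*3)*(4*10)*(9*7)*(12*6))%AC) /=.
by rewrite !subrr !addr0.
Qed.

Lemma zero_action : is_lie_action br (fun _ (_ : H) => 0 : H).
Proof. by split=> *; [move=> a u v|move=> a u v|]; rewrite ?scaler0 ?addr0 ?subr0. Qed.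

End Semidirect.

Section Main.
Variables (K : fieldType) (g H : lmodType K) (br : g -> g -> g).
Variable act : g -> H -> H.
Hypotheses (br_lie : is_lie_bracket br) (act_lie : is_lie_action br act).
Notation V := ((g * H)%type : lmodType K).

Let rho : nmap 2 V V := br_cochain (sum_br br (@abelian_br K H)).
Let alpha : nmap 2 V V := action_cochain act.
Let mu : nmap 2 V V := br_cochain (semidirect_br br act).

Lemma pairP (x y : V) : x.1 = y.1 -> x.2 = y.2 -> x = y.
Proof. by case: x => ? ?; case: y => ? ? /= -> ->. Qed.

(* The scalar 1 gives the shape of the linearity lemmas. *)
Lemma rho_alpha : 1 *: rho + alpha = mu.
Proof.
rewrite scale1r; apply: funext => l; apply: pairP => /=; first exact: addr0.
exact: add0r.
Qed.

Lemma sum_br_lie : is_lie_bracket (sum_br br (@abelian_br K H)).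
Proof.
rewrite (_ : sum_br _ _ = semidirect_br br (fun _ (_ : H) => 0)).
  exact: semidirect_lie br_lie (zero_action _ _).
by apply: funext => x; apply: funext => y; rewrite /semidirect_br subrr.
Qed.

Let cochain_rho : cochain rho := cochain_br_cochain sum_br_lie.
Let cochain_mu : cochain mu := cochain_br_cochain (semidirect_lie br_lie act_lie).

Lemma cochain_alpha : cochain alpha.
Proof.
have -> : alpha = (-1) *: rho + mu.
  by rewrite -rho_alpha scale1r scaleN1r addKr.
exact: (proj2 (cochain_submodule 2 V V)).
Qed.

Lemma vertical_alpha : vertical alpha.
Proof.
split=> [|s|s s0]; first exact: cochain_alpha.
  by rewrite /ev; case: ifP.
rewrite /ev; case: eqP => // szs; case: s szs s0 => [|x [|y []]] //= _.
rewrite /alpha /action_cochain /= andbT => /andP[/eqP -> /eqP ->].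
by rewrite !(linear_fun0 (act_linearl act_lie _)) subrr.
Qed.

(** An insertion is h-valued since the outer map is; as the inner map is h-valued too, arguments in
    h leave the outer map with arguments in h only. *)
Lemma vertical_nr_br p q (P : nmap p.+1 V V) (Q : nmap q.+1 V V) :
  vertical P -> vertical Q -> vertical (nr_br P Q).
Proof.
have ins1 a b (P' : nmap a.+1 V V) (Q' : nmap b.+1 V V) s :
    vertical P' -> vertical Q' -> (ins (ev P') (ev Q') s).1 = 0
      /\ (all (fun x : V => x.1 == 0) s -> ins (ev P') (ev Q') s = 0).
  move=> [_ P1 _] [_ Q1 Q0]; split.
    rewrite /ins (@linear_shsum _ _ _ _ fst) //.
    by apply: shsum_eq0 => A B _; apply: Q1.
  move=> s0; apply: shsum_eq0 => A B pAB; apply: Q0.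
  move: s0; rewrite -(perm_all _ pAB) all_cat /= P1 eqxx.
  by case/andP.
move=> vP vQ; have [[cP _ _] [cQ _ _]] := (vP, vQ).
split=> [|s|s s0]; first exact: cochain_nr_br.
  rewrite ev_nr_br // /gbr /= (proj1 (ins1 _ _ _ _ s vP vQ)).
  by rewrite (proj1 (ins1 _ _ _ _ s vQ vP)) scaler0 subr0.
rewrite ev_nr_br // /gbr (proj2 (ins1 _ _ _ _ s vP vQ) s0).
by rewrite (proj2 (ins1 _ _ _ _ s vQ vP) s0) scaler0 subr0.
Qed.

(** Although rho is not vertical, P inserted into it gives 0, because h is central in the direct
    sum; and rho inserted into P sends arguments in h back into h. *)
Lemma vertical_rho q (P : nmap q.+1 V V) :
  vertical P -> vertical (nr_br rho P).
Proof.
move=> vP; have [cP P1 P0] := vP.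
have br0 y : br 0 y = 0 := linear_fun0 (lie_linearl br_lie y).
have insP s : ins (ev P) (ev rho) s = 0.
  apply: shsum_eq0 => A B _; rewrite /ev /=; case: eqP => // -[].
  case: B => [|y []] //= _; rewrite -/(ev P A) /rho /br_cochain /sum_br /=.
  by rewrite P1 br0.
split=> [|s|s s0]; first exact: cochain_nr_br.
  rewrite ev_nr_br // /gbr insP scaler0 subr0 /ins (@linear_shsum _ _ _ _ fst) //.
  by apply: shsum_eq0 => A B _; apply: P1.
rewrite ev_nr_br // /gbr insP scaler0 subr0.
apply: shsum_eq0 => A B pAB; apply: P0.
move: s0; rewrite -(perm_all _ pAB) all_cat /= => /andP[A0 ->].
rewrite andbT /ev; case: ifP; last by rewrite eqxx.
case: A A0 {pAB} => [|x [|y []]] //= /andP[/eqP x0 _] _.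
by rewrite /rho /br_cochain /= x0 br0.
Qed.

(** The bracket is symmetric in degree 1, so [mu, mu] = [rho, rho] + 2 [rho, alpha] +
    [alpha, alpha]. The squares of mu and rho vanish; divide by 2. *)
Lemma alpha_maurer_cartan : (2%:R : K) != 0 ->
  nr_br rho alpha + 2%:R^-1 *: nr_br alpha alpha = 0.
Proof.
move=> nz2; apply: ev_inj; apply: funext => s.
have ca := cochain_alpha.
have [sr sa] := (iffLR (cochainP rho) cochain_rho, iffLR (cochainP alpha) ca).
have sm := iffLR (cochainP mu) cochain_mu.
have muE t : ev mu t = 1 *: ev rho t + ev alpha t.
  by rewrite -rho_alpha evD evZ.
have := congr1 (fun P => ev P s) (nr_br_lie (semidirect_lie br_lie act_lie)).
rewrite -/mu (ev_nr_br cochain_mu cochain_mu).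
rewrite (gbr_linearr 1 1 s sm muE) (gbr_linearl 1 1 s sr muE).
rewrite (gbr_linearl 1 1 s sa muE).
rewrite -(ev_nr_br cochain_rho cochain_rho) (nr_br_lie sum_br_lie) !ev0.
rewrite !scale1r add0r (gbrC _ _ (ev alpha)) muln1 expr1 scaleN1r opprK addrA => e.
rewrite evD evZ (ev_nr_br cochain_rho ca) (ev_nr_br ca ca).
apply: (scalerI nz2); rewrite scaler0 scalerDr scalerA mulfV // scale1r -e.
by rewrite scaler_nat.
Qed.

(** * Chevalley-Eilenberg cochains inside C_> *)

Lemma map_del (T U : Type) (f : T -> U) i (s : seq T) :
  map f (del i s) = del i (map f s).
Proof. by rewrite /del map_cat map_take map_drop. Qed.

Lemma size_del (T : Type) i (s : seq T) n :
  (i < n.+1)%N -> size s = n.+1 -> size (del i s) = n.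
Proof.
move=> lti szs; rewrite size_cat size_drop size_takel szs; last exact: ltnW.
by rewrite subSS subnKC.
Qed.

Lemma ev_ce_incl k (c : nmap k.+1 g H) s :
  ev (ce_incl c) s = (0, ev c (map fst s)) :> V.
Proof.
rewrite /ev size_map; case: eqP => // szs; congr (_, c _); apply: funext => i.
by rewrite (nth_map 0) // szs.
Qed.

Lemma ev_ce_incl_pair k (c : nmap k.+1 g H) t :
  ev c t = (ev (ce_incl c) (map (fun x => (x, 0) : V) t)).2.
Proof. by rewrite ev_ce_incl /= -map_comp map_id. Qed.

Lemma cochain_ce_incl k (c : nmap k.+1 g H) :
  cochain (ce_incl c) <-> cochain c.
Proof.
split=> /cochainP [lc sc]; apply/cochainP.
  split=> [s1 s2 a x y|s1 s2 x y]; rewrite !ev_ce_incl_pair !map_cat /=.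
    rewrite (_ : (a *: x + y, 0) = a *: ((x, 0) : V) + (y, 0)) ?lc //.
    by apply: pairP => //=; rewrite scaler0 addr0.
  by rewrite sc.
split=> [s1 s2 a x y|s1 s2 x y]; rewrite !ev_ce_incl !map_cat /=;
  apply: pairP => /=.
- by rewrite scaler0 addr0.
- exact: lc.
- by rewrite oppr0.
exact: sc.
Qed.

Lemma vertical_ce_incl k (c : nmap k.+1 g H) : cochain c -> vertical (ce_incl c).
Proof.
move=> cc; split=> [|s|s s0]; first exact/cochain_ce_incl.
  by rewrite ev_ce_incl.
rewrite ev_ce_incl; case: s s0 => [|x s] //= /andP[/eqP -> _].
by rewrite (linear_fun0 (skew_lin _ (iffLR (cochainP c) cc))).
Qed.

Lemma ce_incl_linear k a (c c' : nmap k.+1 g H) :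
  ce_incl (a *: c + c') = a *: ce_incl c + ce_incl c'.
Proof.
by apply: funext => l; apply: pairP => //=; rewrite scaler0 addr0.
Qed.

Lemma ce_incl_inj k : injective (@ce_incl K g H k).
Proof.
move=> c c' e; apply: ev_inj; apply: funext => t.
by rewrite !ev_ce_incl_pair e.
Qed.

Lemma ce_diffE k (c : nmap k.+1 g H) (x : seq g) : size x = k.+2 ->
  ev (ce_diff br act c) x =
    \sum_(i < k.+2) (-1) ^+ i.+1 *: act x`_i (ev c (del i x))
    + \sum_(i < k.+2) \sum_(j < k.+2 | (i < j)%N)
        (-1) ^+ (i + j).+1 *: ev c (br x`_i x`_j :: del i (del j x)).
Proof.
move=> szx; rewrite {1}/ev szx eqxx /ce_diff; congr (_ + _).
  apply: eq_bigr => i _; rewrite /ev (size_del (ltn_ord i) szx) eqxx.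
  by congr (_ *: act _ (c _)); apply: funext => t; rewrite nth_del.
apply: eq_bigr => i _; apply: eq_bigr => j ij; congr (_ *: _).
have szj := size_del (ltn_ord j) szx.
have lti : (i < k.+1)%N by have := ltn_ord j; lia.
rewrite /ev /= (size_del lti szj) eqxx; congr c; apply: funext => -[[|t] ltt] //=.
rewrite !nth_del inordK // /bump; lia.
Qed.

Lemma ce_incl_diff k (c : nmap k.+1 g H) : cochain c ->
  ce_incl (ce_diff br act c)
  = nr_br (p := 1) rho (ce_incl c) + nr_br (p := 1) alpha (ce_incl c).
Proof.
move=> cc; have vc := vertical_ce_incl cc; have [cf f1 _] := vc.
have [sc sf] := (iffLR (cochainP c) cc, iffLR (cochainP _) cf).
apply: ev_inj; apply: funext => s; apply: pairP.
  have [_ r1 _] := vertical_rho vc.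
  have [_ a1 _] := vertical_nr_br vertical_alpha vc.
  by rewrite ev_ce_incl [in RHS]evD /= (r1 s) (a1 s) addr0.
rewrite -[nr_br rho _]scale1r -nr_br_linearl ?rho_alpha //; last exact: cochain_alpha.
have [szs|/eqP szs] := eqVneq (size s) k.+2; last by rewrite !homog_ev.
rewrite ev_ce_incl [LHS]/= ce_diffE ?size_map // (ev_nr_br cochain_mu cf) /gbr /=.
(* The insertion of mu into c is the second sum of [ce_diff]: only the g-component [g_i, g_j] of mu
   is seen by c. *)
rewrite addrC; congr (_ + _).
  rewrite /ins (@linear_shsum _ _ _ _ snd) //.
  rewrite (shsum_two szs) => [|A B szA]; last first.
    by rewrite (homog_ev _ szA) (linear_fun0 (skew_lin _ sf)).
  apply: eq_bigr => i _; apply: eq_bigr => j _; congr (_ *: _).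
  rewrite ev_ce_incl /= !map_del.
  by rewrite !(nth_map 0) ?szs //.
(* The insertion of c into mu is the first sum: [shsumC] moves the single argument left over by c
   into the first block, and mu(c, g_i) = - g_i . c because c has g-component 0. *)
rewrite /ins (@linear_shsum _ _ _ _ snd) // shsumC.
rewrite (shsum_one szs) => [|A B szA]; last first.
  by rewrite homog_ev /= ?scaler0 // => -[].
rewrite -scaleNr scaler_sumr; apply: eq_bigr => i _.
rewrite !scalerA (size_del (ltn_ord i) szs) ev_ce_incl map_del.
rewrite /ev /= (linear_fun0 (act_linearl act_lie _)) add0r scalerN -scaleNr.
rewrite (nth_map 0) ?szs //; congr (_ *: _).
rewrite !mul1n !mulNr opprK -!exprD -signr_odd -[RHS]signr_odd; congr (_ ^+ _).
by rewrite !(oddD, oddS); case: (odd k); case: (odd i).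
Qed.

Lemma vertical_dgLa (D : forall k, nmap k.+1 V V -> nmap k.+2 V V) nu :
    (2%:R : K) != 0 -> cochain nu -> nr_br nu nu = 0 ->
    (forall k P, vertical P -> D k P = nr_br (p := 1) nu P) ->
    (forall k P, vertical P -> vertical (D k P)) ->
  is_dgLa (@DgLaData K (fun k => nmap k.+1 V V) (@Cgt_part K g H)
    (fun p q P Q => nr_br P Q) D).
Proof.
move=> nz2 cnu nunu DE Dv; apply: (nr_dgLa nz2 cnu nunu).
- move=> k; rewrite (_ : @Cgt_part _ _ _ k = [set P | vertical P]%classic).
    exact: vertical_submodule.
  by apply/seteqP; split=> P /Cgt_partP.
- by move=> k P /Cgt_partP[].
- by move=> p q P Q /Cgt_partP vP /Cgt_partP vQ; apply/Cgt_partP/vertical_nr_br.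
- by move=> k P /Cgt_partP; apply: DE.
by move=> k P /Cgt_partP vP; apply/Cgt_partP/Dv.
Qed.

End Main.

Theorem proposition3p2 (K : fieldType) (char0 : [pchar K] =i pred0)
    (g : lmodType K) (br : g -> g -> g) (br_lie : is_lie_bracket br)
    (H : lmodType K) (act : g -> H -> H) (act_lie : is_lie_action br act) :
  let L := Cgt br (@abelian_br K H) in
  let alpha : dg_space L 1 := action_cochain act in
  [/\ is_dgLa L,
      is_maurer_cartan alpha
    & is_sub_dgLa (C := chevalley_eilenberg br act)
        (V := tangent_complex alpha) (@ce_incl K g H)].
Proof.
have nz2 : (2%:R : K) != 0 by apply/negPf; rewrite -[RHS](char0 2%N).
have cochain_rho := cochain_br_cochain (sum_br_lie H br_lie).
have cmu := cochain_br_cochain (semidirect_lie br_lie act_lie).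
have vr := vertical_rho (H := H) br_lie.
have valpha := vertical_alpha br_lie act_lie.
split.
- apply: vertical_dgLa cochain_rho _ _ _ => //.
  exact: nr_br_lie (sum_br_lie H br_lie).
- split; first exact/Cgt_partP.
  exact: alpha_maurer_cartan.
split=> /=.
- apply: (vertical_dgLa nz2 cmu (nr_br_lie (semidirect_lie br_lie act_lie))).
    move=> k P [cP _ _]; rewrite -rho_alpha nr_br_linearl ?scale1r //.
      by case: valpha.
    by rewrite -[br_cochain (sum_br _ _)]scale1r rho_alpha.
  move=> k P vP; have [_ vD] := vertical_submodule g H k.+2.
  by have := vD 1 _ _ (vr _ _ vP) (vertical_nr_br valpha vP); rewrite scale1r.
- by move=> k; apply: cochain_submodule.
(* Antisymmetry of delta c is read off from its inclusion, which is d_alpha of a vertical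
   cochain. *)
- move=> k c cc; apply/cochain_ce_incl; rewrite ce_incl_diff //.
  have [[c1 _ _] [c2 _ _]] := (vr _ _ (vertical_ce_incl cc),
                               vertical_nr_br valpha (vertical_ce_incl cc)).
  by have := proj2 (cochain_submodule _ _ _) 1 _ _ c1 c2; rewrite scale1r.
- by move=> k a c c' _ _; apply: ce_incl_linear.
- by move=> k c c' _ _; apply: ce_incl_inj.
- by move=> k c cc; apply/Cgt_partP/vertical_ce_incl.
(* The induced bracket is zero: an inserted value has g-component 0, and the outer cochain sees only
   g-components. *)
- move=> i j c c' cc cc'; exists 0; first by case: (cochain_submodule (i + j).+1 g H).
  have [ci _ _] := vertical_ce_incl cc; have [cj _ _] := vertical_ce_incl cc'.
  have ins0 p q (d : nmap p.+1 g H) (d' : nmap q.+1 g H) s :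
      cochain d' -> ins (ev (ce_incl d)) (ev (ce_incl d')) s = 0.
    move=> cd'; apply: shsum_eq0 => A B _; rewrite !ev_ce_incl /=.
    by rewrite (linear_fun0 (skew_lin _ (iffLR (cochainP d') cd'))).
  apply: ev_inj; apply: funext => s.
  rewrite ev_nr_br // /gbr !ins0 // scaler0 subr0 ev_ce_incl ev0.
  by [].
by move=> k c cc; apply: ce_incl_diff.
Qed.
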